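(* Consider any instance of the Correlated Pandora's Problem with boxes $[n]$, opening costs $c_i>0$ and scenario distribution $\mathcal{D}$ over $[0,\infty)^n$. Let $X=(X_i)_{i\in[n]}$ be an optimal solution of the General-Cost Convex Program (General CP) below. Then the expected objective of Balanced Stopping with Poisson Rounding (built from $X$) is at most $4\cdot \mathrm{OPT}$, where $\mathrm{OPT}$ is the optimal expected objective of a partially adaptive algorithm. That is, Balanced Stopping with Poisson Rounding is a $4$-approximation to the optimal partially adaptive algorithm.
   Context: Correlated Pandora's Problem: there are boxes $[n]=\{1,\dots,n\}$. Box $i$ has a deterministic opening cost $c_i$ and a volume $v_i\ge 0$; the vector $v=(v_1,\dots,v_n)$ (the scenario) is drawn from a known, possibly correlated, distribution $\mathcal{D}$ over $[0,\infty)^n$. Opening box $i$ costs $c_i$ and reveals $v_i$. An algorithm repeatedly either opens another box or stops and takes an opened box of minimum volume (if all boxes are opened it takes the minimum volume). Its objective is the total opening cost plus the volume of the taken box, to be minimized in expectation. A partially adaptive algorithm fixes an order of the boxes in advance (independent of $v$), opens boxes in this order, and after each opening adaptively decides whether to stop. $\mathrm{OPT}$ is the minimum expected objective over partially adaptive algorithms. Write $x_+=\max\{x,0\}$. General CP: the variables are functions $X_i:[0,\infty)\to[0,1]$, $i\in[n]$, each non-decreasing, subject to $\sum_{i\in[n]}\big(X_i(t)-X_i((t-c_i)_+)\big)\le 1$ for all $t\ge 0$; the objective to minimize is $\mathbf{E}_{v\sim\mathcal{D}}\int_0^\infty\big(1-\sum_{i\in[n]}X_i((t-v_i-c_i)_+)\big)_+\,dt$.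 Poisson Rounding: let $\bar x_i(t)=\frac1t\int_0^t\big(X_i(t')-X_i((t'-c_i)_+)\big)\,dt'$. Independently for each box $i$, arrivals of box $i$ form a non-homogeneous Poisson process (in the ''Poisson time'' $\tau\ge 0$) with rate $\frac{1}{c_i}\bar x_i(\tau/2)$; let $\alpha_i$ be the first arrival time of box $i$ ($\alpha_i=\infty$ if none). Balanced Stopping: for scenario $v$ let $\beta_i=c_i+v_i$, $\tau_i=\max\{\alpha_i,\beta_i\}$, $\tau^*=\min_i\tau_i$ and $i^*=\arg\min_i\tau_i$. Proceeding in Poisson time, the algorithm opens box $i$ at time $\alpha_i$ (revealing $v_i$), and at time $\tau^*$ stops and takes box $i^*$. Thus in real time it opens, one after another in ascending order of $\alpha_j$, exactly the boxes with $\alpha_j\le\tau^*$, and its objective is $\sum_{j:\alpha_j\le\tau^*}c_j$ plus the volume of the taken box (at most $v_{i^*}$).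
   Formalization: The constraint X_i(0)=0 is added to the General CP; without it X_i≡1 is feasible with objective 0, all Poisson rates vanish, no box is ever opened, and the claim fails. *)

(* Defs.v *)
From HB Require Import structures.
From mathcomp Require Import all_boot all_order all_algebra all_fingroup.
From mathcomp Require Import all_classical all_reals all_analysis measurable_realfun.
Set Implicit Arguments. Unset Strict Implicit. Unset Printing Implicit Defensive.
Import Order.TTheory GRing.Theory Num.Theory.
Import numFieldNormedType.Exports.
Local Open Scope classical_set_scope.
Local Open Scope ring_scope.

Section PandoraDefs.
Variable R : realType.

Definition cp_feasible (n : nat) (c : 'I_n -> R) (X : 'I_n -> R -> R) : Prop :=
  [/\ (forall i t, 0 <= t -> 0 <= X i t <= 1),
      (forall i s t, 0 <= s -> s <= t -> X i s <= X i t),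
      (forall i, X i 0 = 0) &
      (forall t, 0 <= t -> \sum_(i < n) (X i t - X i (Num.max (t - c i) 0)) <= 1)].

(* Objective of the General CP:
   E_{v ~ D} int_0^oo (1 - sum_i X_i((t - v_i - c_i)_+))_+ dt,
   the scenario being the random vector v on the probability space (T,P). *)
Definition cp_obj (n : nat) d (T : measurableType d) (P : probability T R)
    (c : 'I_n -> R) (v : 'I_n -> T -> R) (X : 'I_n -> R -> R) : \bar R :=
  (\int[P]_w
     (\int[@lebesgue_measure R]_(t in `[0%R, +oo[)
        (Num.max (1 - \sum_(i < n) X i (Num.max (t - v i w - c i) 0)) 0)%:E))%E.

Definition cp_optimal (n : nat) d (T : measurableType d) (P : probability T R)
    (c : 'I_n -> R) (v : 'I_n -> T -> R) (X : 'I_n -> R -> R) : Prop :=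
  cp_feasible c X /\
  forall Y : 'I_n -> R -> R, cp_feasible c Y -> (cp_obj P c v X <= cp_obj P c v Y)%E.

Definition xbar (n : nat) (c : 'I_n -> R) (X : 'I_n -> R -> R) (i : 'I_n) (t : R) : R :=
  t^-1 * \int[@lebesgue_measure R]_(s in `[0%R, t]) (X i s - X i (Num.max (s - c i) 0)).

(* Cumulative rate Lambda_i(tau) = int_0^tau (1/c_i) xbar_i(s/2) ds of the
   non-homogeneous Poisson process of box i (in Poisson time). *)
Definition Lambda (n : nat) (c : 'I_n -> R) (X : 'I_n -> R -> R) (i : 'I_n) (tau : R) : R :=
  \int[@lebesgue_measure R]_(s in `[0%R, tau]) ((c i)^-1 * xbar c X i (s / 2)).

(* alpha_i (valued in [0,+oo], +oo = no arrival) is distributed as the first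
   arrival time of that process: P(alpha_i > tau) = exp(-Lambda_i(tau)). *)
Definition first_arrival_law (n : nat) d (T : measurableType d) (P : probability T R)
    (c : 'I_n -> R) (X : 'I_n -> R -> R) (alpha : 'I_n -> T -> \bar R) : Prop :=
  forall i (tau : R), 0 <= tau ->
    P [set w | (tau%:E < alpha i w)%E] = (expR (- Lambda c X i tau))%:E.

(* Mutual independence of the random vector v (jointly) and of alpha_1..alpha_n:
   product rule on all measurable rectangles (a generating pi-system). *)
Definition indep_scen_arrivals (n : nat) d (T : measurableType d) (P : probability T R)
    (v : 'I_n -> T -> R) (alpha : 'I_n -> T -> \bar R) : Prop :=
  forall (B : 'I_n -> set R) (A : 'I_n -> set (\bar R)),
    (forall j, measurable (B j)) -> (forall i, measurable (A i : set (\bar R))) ->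
    P ((\bigcap_(j in [set: 'I_n]) (v j @^-1` B j)) `&`
       (\bigcap_(i in [set: 'I_n]) (alpha i @^-1` A i)))
    = (P (\bigcap_(j in [set: 'I_n]) (v j @^-1` B j)) *
       \prod_(i < n) P (alpha i @^-1` A i))%E.

(* tau* = min_i max(alpha_i, c_i + v_i).  The algorithm opens exactly the boxes
   with alpha_j <= tau* and takes an opened box of minimum volume.  If tau* = +oo
   (no arrival at all) the algorithm never stops: cost +oo. *)
Definition tau_star (n : nat) (c v : 'I_n -> R) (a : 'I_n -> \bar R) : \bar R :=
  \big[Order.min/+oo%E]_(i < n) Order.max (a i) (c i + v i)%:E.

Definition bs_cost (n : nat) (c v : 'I_n -> R) (a : 'I_n -> \bar R) : \bar R :=
  let ts := tau_star c v a in
  if ts == +oo%E then +oo%E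
  else (\sum_(j < n | (a j <= ts)%E) (c j)%:E
        + \big[Order.min/+oo%E]_(j < n | (a j <= ts)%E) (v j)%:E)%E.

(* A partially adaptive algorithm: a fixed order sigma, and a stopping rule
   stop k (values revealed by the first k openings) deciding whether to stop
   after the k-th opening (k = 1..n); it must stop when all boxes are open. *)
Definition revealed (n : nat) (sigma : {perm 'I_n}) (v : 'I_n -> R) (k : nat) : seq R :=
  [seq v (sigma j) | j <- [seq j : 'I_n <- enum 'I_n | (val j < k)%N]].

Definition n_opened (n : nat) (sigma : {perm 'I_n}) (stop : nat -> seq R -> bool)
    (v : 'I_n -> R) : nat :=
  head n [seq k <- iota 1 n | stop k (revealed sigma v k)].

Definition pa_cost (n : nat) (c : 'I_n -> R) (sigma : {perm 'I_n})
    (stop : nat -> seq R -> bool) (v : 'I_n -> R) : \bar R :=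
  let K := n_opened sigma stop v in
  (\sum_(j < n | (j < K)%N) (c (sigma j))%:E
   + \big[Order.min/+oo%E]_(j < n | (j < K)%N) (v (sigma j))%:E)%E.

Definition pa_admissible (n : nat) d (T : measurableType d)
    (v : 'I_n -> T -> R) (sigma : {perm 'I_n}) (stop : nat -> seq R -> bool) : Prop :=
  forall k, measurable [set w | stop k (revealed sigma (fun i => v i w) k)].

Definition OPT (n : nat) d (T : measurableType d) (P : probability T R)
    (c : 'I_n -> R) (v : 'I_n -> T -> R) : \bar R :=
  ereal_inf [set e | exists (sigma : {perm 'I_n}) (stop : nat -> seq R -> bool),
     pa_admissible v sigma stop /\
     e = (\int[P]_w pa_cost c sigma stop (fun i => v i w))%E].

End PandoraDefs.

(* Main.v *)
(* An order of the boxes is a 0/1 solution of the General CP whose value is at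
   most the cost of any stopping rule for that order, so the CP optimum is at
   most OPT. By independence and Fubini it remains to bound, for a fixed scenario
   v, the mean cost by four times int_0^oo (1 - sum_i X_i((t - v_i - c_i)_+))_+ dt.

   Put b_i = c_i + v_i and let S(s) = exp(- sum_{b_i <= s} Lambda_i(s)) be the
   probability that the algorithm still runs at Poisson time s. The opening cost
   is at most int S because sum_i c_i Lambda_i' <= 1. The volume taken is at most
   tau_star, and at most tau_star - (s - v_i) if an arrival of box i at time
   s >= b_i stops the process. Hence the mean cost is at most
   int S (2 - sum_{b_i <= s} (s - v_i) Lambda_i').

   Let h_i <= X_i((. - c_i)_+) be a truncation keeping the total mass at most 1,
   a_i(s) = h_i(s/2) for b_i <= s, Q = sum a_i and V = sum v_i a_i. Since
   Lambda_i'(s) >= 2 a_i(s) / s, S(s) <= exp(- 2/3 Q(2s/3)) and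
   V(2s/3) / s <= 2/3 Q(2s/3), the inequality (1 + x) exp(-x) <= 1 bounds the
   integrand by 2 (1 - Q) + 2 (V(s) - V(2s/3)) / s + V(oo) S sum_i Lambda_i',
   whose last two terms integrate to at most V(oo) each. Shifting each h_i by v_i
   turns int (1 - Q) + V(oo) into at most twice the CP integral.

   All this is carried out on a geometric grid with ratio r, r^m = 3/2: the map
   s -> 2s/3 is then a shift by m grid points, and the errors vanish as m grows. *)
Require Import Defs.
From HB Require Import structures.
From mathcomp Require Import all_boot all_order all_algebra all_fingroup.
From mathcomp Require Import all_classical all_reals all_analysis measurable_realfun.
From mathcomp Require Import ring lra.
Import Order.TTheory GRing.Theory Num.Theory.
Import numFieldNormedType.Exports.
Local Open Scope classical_set_scope.
Local Open Scope ring_scope.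
Set Implicit Arguments. Unset Strict Implicit. Unset Printing Implicit Defensive.

(** * Integration of bounded measurable functions over compact intervals *)

Section BoundedMeasurable.
Variable R : realType.
Notation mu := (@lebesgue_measure R).
Implicit Types (f g : R -> R) (a b k : R).

(** A class closed under the operations used below and integrable on every compact interval, so that
    one closure argument settles each integrability condition. *)
Definition bmeas f := measurable_fun setT f /\ exists B, forall x, `|f x| <= B.

Lemma bmeas_cst k : bmeas (fun=> k).
Proof. by split; [exact: measurable_cst | exists `|k|]. Qed.

Lemma bmeasD f g : bmeas f -> bmeas g -> bmeas (fun x => f x + g x).
Proof.
move=> [mf [B fB]] [mg [C gC]]; split; first exact: measurable_funD.
by exists (B + C) => x; rewrite (le_trans (ler_normD _ _))// lerD.
Qed.

Lemma bmeasM f g : bmeas f -> bmeas g -> bmeas (fun x => f x * g x).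
Proof.
move=> [mf [B fB]] [mg [C gC]]; split; first exact: measurable_funM.
by exists (B * C) => x; rewrite normrM ler_pM.
Qed.

Lemma bmeasB f g : bmeas f -> bmeas g -> bmeas (fun x => f x - g x).
Proof.
move=> bf bg; rewrite (_ : (fun x => _) = fun x => f x + (-1) * g x).
  by apply: bmeasD => //; apply: bmeasM => //; exact: bmeas_cst.
by apply/funext => x; rewrite mulN1r.
Qed.

Lemma bmeas_sum n (F : 'I_n -> R -> R) :
  (forall i, bmeas (F i)) -> bmeas (fun x => \sum_(i < n) F i x).
Proof.
elim: n F => [|n IH] F bF.
  by under eq_fun do rewrite big_ord0; exact: bmeas_cst.
by under eq_fun do rewrite big_ord_recr; apply: bmeasD => //; exact: IH.
Qed.

Lemma bmeas_comp f g : bmeas f -> measurable_fun setT g -> bmeas (fun x => f (g x)).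
Proof.
by move=> [mf [B fB]] mg; split; [exact: measurableT_comp | exists B].
Qed.

Lemma nondecreasing_bmeas f B : {homo f : x y / x <= y} ->
  (forall x, 0 <= f x <= B) -> bmeas f.
Proof.
move=> fm f01; split; first exact: nondecreasing_measurable.
by exists B => x; case/andP: (f01 x) => f0 f1; rewrite ger0_norm.
Qed.

Lemma bmeas_affine k b : measurable_fun setT (fun x : R => k * x + b).
Proof.
apply: measurable_funD; last exact: measurable_cst.
apply: measurable_funM => //; exact: measurable_cst.
Qed.

Lemma bmeas_integrable f a b : bmeas f -> mu.-integrable `[a, b] (EFin \o f).
Proof.
move=> [mf [B fB]]; apply: measurable_bounded_integrable => //.
- by rewrite /= lebesgue_measure_itv /=; case: ifP => // _; rewrite -EFinB ltry.
- exact: measurable_funS mf.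
- exists B; split; first exact: num_real.
  by move=> M BM x _; apply: le_trans (fB x) _; exact: ltW.
Qed.

Lemma Rint_le f g a b : bmeas f -> bmeas g ->
  (forall x, a <= x <= b -> f x <= g x) ->
  \int[mu]_(x in `[a, b]) f x <= \int[mu]_(x in `[a, b]) g x.
Proof.
move=> bf bg fg; apply: (le_Rintegral _ (bmeas_integrable _ _ bf) (bmeas_integrable _ _ bg)) => //.
Qed.

Lemma eq_Rint f g a b : (forall x, a <= x <= b -> f x = g x) ->
  \int[mu]_(x in `[a, b]) f x = \int[mu]_(x in `[a, b]) g x.
Proof.
by move=> fg; apply: eq_Rintegral => x; rewrite inE /= in_itv /=; exact: fg.
Qed.

Lemma Rint_cst k a b : a <= b -> \int[mu]_(x in `[a, b]) k = k * (b - a).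
Proof.
move=> ab; rewrite Rintegral_cst //= lebesgue_measure_itv /= lte_fin.
case: ltP => // ba; have -> : a = b by apply: le_anti; rewrite ab.
by rewrite subrr.
Qed.

Lemma Rint_chasles f a b d : bmeas f -> a <= b -> b <= d ->
  \int[mu]_(x in `[a, d]) f x =
  \int[mu]_(x in `[a, b]) f x + \int[mu]_(x in `[b, d]) f x.
Proof.
move=> bf ab bd.
have := @Rintegral_itvB R f (BLeft a) (BRight d) b (bmeas_integrable _ _ bf).
rewrite !bnd_simp => /(_ ab bd).
rewrite Rintegral_itv_obnd_cbnd; first by move=> <-; rewrite addrC subrK.
apply: integrableS (bmeas_integrable b d bf) => //.
by apply: subset_itvr; rewrite bnd_simp.
Qed.

Lemma Rint_sum n (F : 'I_n -> R -> R) a b : (forall i, bmeas (F i)) ->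
  \int[mu]_(x in `[a, b]) (\sum_(i < n) F i x) =
  \sum_(i < n) \int[mu]_(x in `[a, b]) F i x.
Proof.
elim: n F => [|n IH] F bF.
  rewrite big_ord0; under eq_Rintegral do rewrite big_ord0.
  by rewrite Rintegral_cst // mul0r.
rewrite big_ord_recr -IH //=.
under eq_Rintegral do rewrite big_ord_recr /=.
rewrite RintegralD //; apply: bmeas_integrable => //.
exact: bmeas_sum.
Qed.

(** Uniqueness of Lebesgue measure: [k] times the pushforward under the affine map gives half-open
    intervals their length. *)
Lemma lebesgue_measure_affine k b (A : set R) : 0 < k -> measurable A ->
  mu ((fun x : R => k * x + b) @^-1` A) = ((k^-1)%:E * mu A)%E.
Proof.
move=> k0 mA; have kV0 : 0 <= k by exact: ltW.
pose phi : measurableTypeR R -> measurableTypeR R := fun x => k * x + b.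
have mphi : measurable_fun setT phi by exact: bmeas_affine.
pose mm := mscale (NngNum kV0) (pushforward mu phi).
have := @lebesgue_measure_unique R (mm mphi); move=> /(_ _ A mA) ->; last first.
  move=> _ [[x y] /= _ <-].
  change (mu `]x, y] = (k%:E * mu (phi @^-1` `]x, y]))%E).
  have -> : phi @^-1` `]x, y] = `](x - b) / k, (y - b) / k]%classic.
    apply/seteqP; split => z /=; rewrite /phi !in_itv /= ltr_pdivrMr// ler_pdivlMr//;
      rewrite (mulrC z); move=> /andP[? ?]; apply/andP; split; lra.
  rewrite !lebesgue_measure_itv /= !lte_fin ltr_pM2r ?invr_gt0// ltrD2r.
  case: ifP => _; last by rewrite mule0.
  rewrite -!EFinB -EFinM; congr EFin; field; exact: lt0r_neq0.
rewrite /mm /mscale /= muleA -EFinM mulVf ?lt0r_neq0// mul1e.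
by [].
Qed.

Lemma Rint_affine f k d a b : 0 < k -> bmeas f -> (forall x, 0 <= f x) ->
  \int[mu]_(x in `[a, b]) f (k * x + d) =
  k^-1 * \int[mu]_(x in `[k * a + d, k * b + d]) f x.
Proof.
move=> k0 bf f0; have kV0 : 0 <= k^-1 by rewrite invr_ge0 ltW.
pose phi : measurableTypeR R -> measurableTypeR R := fun x => k * x + d.
have mphi : measurable_fun setT phi by exact: bmeas_affine.
have mfE : measurable_fun (`[k * a + d, k * b + d] : set R) (EFin \o f).
  by apply/measurable_EFinP; apply: measurable_funS bf.1.
have H : (\int[mu]_(x in `[a, b]) (f (k * x + d)%R)%:E =
  (k^-1)%:E * \int[mu]_(x in `[(k * a + d)%R, (k * b + d)%R]) (f x)%:E)%E.
  rewrite -(@ge0_integral_mscale _ _ _ _ _ _ (NngNum kV0)) //; last first.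
    by move=> x _; rewrite lee_fin.
  rewrite [RHS](@eq_measure_integral _ _ _ _ (pushforward mu phi)); last first.
    by move=> A mA _; rewrite /mscale /= /pushforward lebesgue_measure_affine.
  rewrite ge0_integral_pushforward //; last first.
    by move=> x _; rewrite lee_fin.
  rewrite (_ : phi @^-1` _ = `[a, b]%classic) //.
  by apply/seteqP; split => z /=; rewrite /phi !in_itv /= !lerD2r !ler_pM2l.
rewrite /Rintegral H fineM //.
by apply: integrable_fin_num => //; exact: bmeas_integrable.
Qed.

Lemma Rint_shift f d a b : bmeas f -> (forall x, 0 <= f x) ->
  \int[mu]_(x in `[a, b]) f (x - d) = \int[mu]_(x in `[a - d, b - d]) f x.
Proof.
move=> bf f0; have := @Rint_affine f 1 (- d) a b ltr01 bf f0.
by rewrite invr1 !mul1r => <-; apply: eq_Rint => x _; rewrite mul1r.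
Qed.

Lemma measurable_fun_inv : measurable_fun setT (fun x : R => x^-1).
Proof.
have -> : setT = ~` [set 0 : R] `|` [set 0] by rewrite setUC setUv.
apply/measurable_funU => //; first exact: measurableC.
split; last exact: measurable_fun_set1.
apply: open_continuous_measurable_fun.
  by apply: closed_openC; exact: closed_eq.
by move=> x; rewrite inE /= => /eqP x0; exact: inv_continuous.
Qed.

End BoundedMeasurable.

(** * Growth of the cumulative Poisson rates *)

Section Rates.
Variables (R : realType) (n : nat) (c : 'I_n -> R) (X : 'I_n -> R -> R).
Hypothesis hc : forall i, 0 < c i.
Hypothesis hX : cp_feasible c X.
Notation mu := (@lebesgue_measure R).

(** Extension by [X i 0 = 0] to negative times: it is monotone on the whole line and absorbs the
    positive parts in the program. *)
Definition Xpos i t := X i (Num.max t 0).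

Lemma Xpos_homo i : {homo Xpos i : s t / s <= t}.
Proof.
case: hX => _ hm _ _ s t st; apply: hm; first by rewrite le_max lexx orbT.
by rewrite ge_max !le_max st lexx !orbT.
Qed.

Lemma Xpos_bounds i t : 0 <= Xpos i t <= 1.
Proof. by case: hX => h _ _ _; apply: h; rewrite le_max lexx orbT. Qed.

Lemma Xpos_le0 i t : t <= 0 -> Xpos i t = 0.
Proof. by case: hX => _ _ h _ t0; rewrite /Xpos max_r. Qed.

Lemma Xpos_bmeas i : bmeas (Xpos i).
Proof. exact: nondecreasing_bmeas (@Xpos_homo i) (@Xpos_bounds i). Qed.

Let phi i s := Xpos i s - Xpos i (s - c i).

Let phi_bmeas i : bmeas (phi i).
Proof.
apply: bmeasB; first exact: Xpos_bmeas.
apply: (bmeas_comp (Xpos_bmeas i)).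
by apply: measurable_funB => //; exact: measurable_cst.
Qed.

Let phi_ge0 i s : 0 <= phi i s.
Proof. by rewrite subr_ge0 Xpos_homo// gerBl ltW. Qed.

Let phi_le1 i s : phi i s <= 1.
Proof.
by rewrite lerBlDr (le_trans (andP (Xpos_bounds i s)).2)// lerDl (andP (Xpos_bounds _ _)).1.
Qed.

Let J i t := \int[mu]_(s in `[0, t]) phi i s.

Let xbarE i t : xbar c X i t = t^-1 * J i t.
Proof.
rewrite /xbar; congr (_ * _); apply: eq_Rint => s /andP[s0 _].
by rewrite /phi /Xpos (max_l s0).
Qed.

Let J_le0 i t : t <= 0 -> J i t = 0.
Proof.
move=> t0; rewrite /J; move: t0; rewrite le_eqVlt => /orP[/eqP->|t0].
  by rewrite set_itv1 Rintegral_set1.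
by rewrite set_itv_ge ?Rintegral_set0 // bnd_simp -ltNge.
Qed.

Let J_homo i : {homo J i : s t / s <= t}.
Proof.
move=> s t st; case: (leP 0 s) => s0; last first.
  by rewrite (J_le0 _ (ltW s0)); apply: Rintegral_ge0 => x _.
by rewrite /J (Rint_chasles (phi_bmeas i) s0 st) lerDl; apply: Rintegral_ge0.
Qed.

Let J_ge0 i t : 0 <= J i t.
Proof. exact: Rintegral_ge0. Qed.

Let J_le i t : 0 <= t -> J i t <= t.
Proof.
move=> t0; have := @Rint_le R (phi i) (fun=> 1) 0 t (phi_bmeas i) (bmeas_cst 1).
by rewrite Rint_cst// mul1r subr0; apply => x _.
Qed.

Let sum_J_le t : 0 <= t -> \sum_(i < n) J i t <= t.
Proof.
move=> t0; rewrite -Rint_sum//.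
have := @Rint_le R (fun s => \sum_(i < n) phi i s) (fun=> 1) 0 t
  (bmeas_sum phi_bmeas) (bmeas_cst 1).
rewrite Rint_cst// mul1r subr0; apply => s /andP[s0 _].
case: hX => _ _ _ /(_ s s0); apply: le_trans.
by apply: ler_sum => i _; rewrite /phi /Xpos (max_l s0).
Qed.

(* [J t] is the integral of [X] over the window [[t - c, t]], where
   [X >= X (t - c)]. *)
Let J_ge i t : 0 <= t -> c i * Xpos i (t - c i) <= J i t.
Proof.
move=> t0; have ci := hc i; case: (leP t (c i)) => tc.
  by rewrite Xpos_le0 ?mulr0// subr_le0.
have bX := Xpos_bmeas i.
have X0 x : 0 <= Xpos i x by case/andP: (Xpos_bounds i x).
have tc0 : 0 <= t - c i by rewrite subr_ge0 ltW.
rewrite /J RintegralB//; first last.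
- apply: bmeas_integrable; apply: (bmeas_comp bX).
  by apply: measurable_funB => //; exact: measurable_cst.
- exact: bmeas_integrable.
rewrite Rint_shift// sub0r (Rint_chasles bX (a := - c i) (b := 0)) ?oppr_le0 ?(ltW ci)//.
rewrite (@eq_Rint R (Xpos i) (fun=> 0) (- c i) 0); last first.
  by move=> x /andP[_ x0]; rewrite Xpos_le0.
rewrite Rint_cst ?oppr_le0 ?(ltW ci)// mul0r add0r.
rewrite (Rint_chasles bX tc0); last by rewrite gerBl ltW.
rewrite addrAC subrr add0r.
have := @Rint_le R (fun=> Xpos i (t - c i)) (Xpos i) (t - c i) t (bmeas_cst _) bX.
rewrite Rint_cst ?gerBl ?(ltW ci)// (_ : t - (t - c i) = c i); last by ring.
rewrite mulrC; apply.
by move=> x /andP[? _]; exact: Xpos_homo.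
Qed.

Definition rate i s := (c i)^-1 * xbar c X i (s / 2).

Let rate_ge0 i s : 0 <= rate i s.
Proof.
rewrite /rate xbarE; case: (leP 0 s) => s0.
  by rewrite !mulr_ge0 ?invr_ge0 ?(ltW (hc i))// divr_ge0.
by rewrite J_le0 ?mulr0//; lra.
Qed.

Let c_rateE i s : c i * rate i s = (s / 2)^-1 * J i (s / 2).
Proof. by rewrite /rate xbarE mulVKf// lt0r_neq0. Qed.

(** The average of a function with values in [0, 1] stays bounded near time 0 because [J i t <= t];
    this gives the bound [(c i)^-1]. *)
Let rate_bmeas i : bmeas (rate i).
Proof.
split.
  have -> : rate i = fun s => (c i)^-1 * ((s / 2)^-1 * J i (s / 2)).
    by apply/funext => s; rewrite /rate xbarE.
  have m2 : measurable_fun setT (fun s : R => s / 2).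
    by apply: measurable_funM => //; exact: measurable_cst.
  apply: measurable_funM; first exact: measurable_cst.
  apply: measurable_funM; first exact: (measurableT_comp (@measurable_fun_inv R) m2).
  by apply: (measurableT_comp _ m2); apply: nondecreasing_measurable => //; exact: J_homo.
exists (c i)^-1 => s; rewrite ger0_norm//.
rewrite -(ler_pM2l (hc i)) c_rateE divff ?lt0r_neq0//.
case: (ltP 0 s) => s0; last by rewrite J_le0 ?mulr0//; lra.
by rewrite mulrC ler_pdivrMr ?mul1r ?J_le//; lra.
Qed.

Lemma LambdaB i a b : 0 <= a -> a <= b ->
  Lambda c X i b - Lambda c X i a = \int[mu]_(s in `[a, b]) rate i s.
Proof.
by move=> a0 ab; rewrite /Lambda (Rint_chasles (rate_bmeas i) a0 ab) addrAC subrr add0r.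
Qed.

Lemma Lambda0 i : Lambda c X i 0 = 0.
Proof. by rewrite /Lambda set_itv1 Rintegral_set1. Qed.

Lemma Lambda_le i a b : 0 <= a -> a <= b -> Lambda c X i a <= Lambda c X i b.
Proof.
by move=> a0 ab; rewrite -subr_ge0 LambdaB//; apply: Rintegral_ge0.
Qed.

Lemma Lambda_ge0 i a : 0 <= a -> 0 <= Lambda c X i a.
Proof. by move=> a0; rewrite -(Lambda0 i) Lambda_le. Qed.

(** By [J_ge] the rate at time [s] is at least [2 X_i(s/2 - c_i) / s]; on [[a, b]] bound [X_i] by
    its value at the left end and [1 / s] by that at the right end. The factor depends only on the
    ratio [a / b], hence on a geometric grid only on the number of steps. *)
Lemma LambdaB_ge i a b : 0 < a -> a <= b ->
  2 * (1 - a / b) * Xpos i (a / 2 - c i) <= Lambda c X i b - Lambda c X i a.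
Proof.
move=> a0 ab; have b0 : 0 < b by exact: lt_le_trans ab.
rewrite LambdaB ?(ltW a0)//.
set y := Xpos i _; have y0 : 0 <= y by case/andP: (Xpos_bounds i (a / 2 - c i)).
have := @Rint_le R (fun=> 2 * y / b) (rate i) a b (bmeas_cst _) (rate_bmeas i).
rewrite Rint_cst//; have -> : 2 * y / b * (b - a) = 2 * (1 - a / b) * y.
  by field; rewrite lt0r_neq0.
apply => s /andP[as_ sb]; have s0 : 0 < s by exact: lt_le_trans as_.
rewrite -(ler_pM2l (hc i)) c_rateE.
apply: (@le_trans _ _ ((s / 2)^-1 * (c i * y))); last first.
  rewrite ler_wpM2l ?invr_ge0//; first lra.
  apply: le_trans (J_ge _ _); last lra.
  by rewrite ler_wpM2l ?(ltW (hc i))// Xpos_homo// lerD2r; lra.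
have -> : c i * (2 * y / b) = (c i * y * 2) * b^-1 by ring.
have -> : (s / 2)^-1 * (c i * y) = (c i * y * 2) * s^-1.
  by field; rewrite lt0r_neq0.
rewrite ler_wpM2l//; first by rewrite !mulr_ge0// ltW.
by rewrite lef_pV2.
Qed.

(** The capacity constraint of the program, averaged over [[0, s/2]], says that opening costs accrue
    at mean rate at most 1 in Poisson time. *)
Lemma sum_c_LambdaB_le a b : 0 <= a -> a <= b ->
  \sum_(i < n) c i * (Lambda c X i b - Lambda c X i a) <= b - a.
Proof.
move=> a0 ab.
have cb i : bmeas (fun s => c i * rate i s).
  by apply: bmeasM; [exact: bmeas_cst | exact: rate_bmeas].
under eq_bigr => i _.
  rewrite LambdaB// -RintegralZl//; first over.
  exact: bmeas_integrable.
rewrite -Rint_sum//.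
have := @Rint_le R _ (fun=> 1) a b (bmeas_sum cb) (bmeas_cst 1).
rewrite Rint_cst// mul1r; apply => s /andP[as_ _].
under eq_bigr do rewrite c_rateE.
rewrite -mulr_sumr; case: (ltP 0 s) => s0.
  by rewrite mulrC ler_pdivrMr ?mul1r ?sum_J_le//; lra.
by rewrite big1 ?mulr0// => i _; rewrite J_le0//; lra.
Qed.

(** Each doubling of the time adds at least [y], since [2 (1 - 1/2) = 1] in [LambdaB_ge]. *)
Lemma Lambda_pinfty i t0 : 0 < t0 -> 0 < Xpos i (t0 / 2 - c i) ->
  forall A, exists2 t, 0 <= t & A <= Lambda c X i t.
Proof.
move=> t00 X0 A; set y := Xpos i _ in X0.
have H k : k%:R * y <= Lambda c X i (t0 * 2 ^+ k).
  elim: k => [|k IH]; first by rewrite mul0r expr0 mulr1 Lambda_ge0// ltW.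
  have tk : t0 <= t0 * 2 ^+ k by rewrite ler_pMr// exprn_ege1// ler1n.
  have h := @LambdaB_ge i (t0 * 2 ^+ k) (t0 * 2 ^+ k.+1).
  have {}h : y <= Lambda c X i (t0 * 2 ^+ k.+1) - Lambda c X i (t0 * 2 ^+ k).
    apply: le_trans (h _ _); last 2 first.
    - by rewrite mulr_gt0// exprn_gt0.
    - by rewrite ler_pM2l// exprS ler_peMl ?exprn_ge0// ler1n.
    have -> : t0 * 2 ^+ k / (t0 * 2 ^+ k.+1) = 2^-1.
      have p2 : 2 ^+ k != 0 :> R by rewrite expf_neq0// pnatr_eq0.
      by rewrite exprS; field; rewrite p2 lt0r_neq0.
    have -> : 2 * (1 - 2^-1) = 1 :> R by field.
    by rewrite mul1r Xpos_homo// lerD2r ler_pM2r ?invr_gt0.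
  by rewrite -natr1 mulrDl mul1r; lra.
have [k hk] : exists k : nat, A / y <= k%:R.
  exists (Num.truncn `|A / y|).+1; rewrite (le_trans (ler_norm _))// ltW//.
  exact: truncnS_gt.
exists (t0 * 2 ^+ k); first by rewrite mulr_ge0 ?exprn_ge0// ltW.
by rewrite (le_trans _ (H k))// -ler_pdivrMr.
Qed.

End Rates.

(** * The survival inequality on a geometric grid, for a fixed scenario *)

Lemma bernoulli (R : realType) (r : R) k : 1 <= r -> 1 + k%:R * (r - 1) <= r ^+ k.
Proof.
move=> r1; elim: k => [|k IH]; first by rewrite mul0r addr0 expr0.
rewrite exprS -natr1; apply: le_trans (_ : r * (1 + k%:R * (r - 1)) <= _).
  have : 0 <= k%:R * (r - 1) * (r - 1) by rewrite !mulr_ge0// subr_ge0.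
  by nra.
by rewrite ler_pM2l// (lt_le_trans ltr01).
Qed.

Section GridInequality.
(** Here [h i s] stands for the truncation of [X_i((s - c_i)_+)], which explains why it vanishes up
    to [c i], and [kap i] below stands for its final value. *)
Variables (R : realType) (n : nat) (c v : 'I_n -> R) (Lam h : 'I_n -> R -> R).
Hypothesis hc : forall i, 0 < c i.
Hypothesis hv : forall i, 0 <= v i.
Hypothesis Lam_ge0 : forall i s, 0 <= s -> 0 <= Lam i s.
Hypothesis Lam_le : forall i s t, 0 <= s -> s <= t -> Lam i s <= Lam i t.
Hypothesis h_homo : forall i, {homo h i : s t / s <= t}.
Hypothesis h_le0 : forall i t, t <= c i -> h i t = 0.
Hypothesis LamB_ge : forall i s t, 0 < s -> s <= t ->
  2 * (1 - s / t) * h i (s / 2) <= Lam i t - Lam i s.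

(* [P(tau_star > s) = exp (- hazard s)]. *)
Definition hazard (s : R) := \sum_(i < n | c i + v i <= s) Lam i s.
Definition surv s := expR (- hazard s).

Variables (t0 r : R) (m N : nat).
Hypothesis t00 : 0 < t0.
Hypothesis t0c : forall i, t0 <= c i.
Hypothesis r1 : 1 < r.
Hypothesis rm : r ^+ m = 3 / 2.
Definition grid (t0 r : R) (k : nat) := t0 * r ^+ k.
Notation t := (grid t0 r).
Notation dt k := (t k.+1 - t k).
Notation del := (1 - r^-1).
Variable kap : 'I_n -> R.
Hypothesis h_kap : forall i t, h i t <= kap i.
Hypothesis kap1 : \sum_(i < n) kap i <= 1.

Let h_ge0 i s : 0 <= h i s.
Proof.
case: (leP s (c i)) => sc; first by rewrite h_le0.
by rewrite -(h_le0 (lexx (c i))) h_homo// ltW.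
Qed.

Let kap_ge0 i : 0 <= kap i.
Proof. exact: le_trans (h_ge0 i 0) _. Qed.

Let r0 : 0 < r. Proof. by apply: lt_trans r1. Qed.

Lemma grid_gt0 k : 0 < t k.
Proof. by rewrite mulr_gt0// exprn_gt0. Qed.

Lemma gridS k : t k.+1 = r * t k.
Proof. by rewrite /grid exprS mulrCA. Qed.

Lemma grid_le j k : (j <= k)%N -> t j <= t k.
Proof. by move=> jk; rewrite ler_pM2l// ler_weXn2l// ltW. Qed.

Lemma grid_dt_ge0 k : 0 <= dt k.
Proof. by rewrite subr_ge0 grid_le. Qed.

Let dtE k : dt k = del * t k.+1.
Proof. by rewrite gridS; field; rewrite lt0r_neq0. Qed.

Let del_ge0 : 0 <= del.
Proof. by rewrite subr_ge0 invf_le1// ltW. Qed.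

Let del_le : del <= r - 1.
Proof.
have -> : del = (r - 1) / r by field; rewrite lt0r_neq0.
by rewrite ler_pdivrMr// ler_peMr ?subr_ge0// ltW.
Qed.

Lemma grid_dt_le k : (k < N)%N -> dt k <= (r - 1) * t N.
Proof.
move=> kN; rewrite gridS -{2}(mul1r (t k)) -mulrBl ler_wpM2l ?subr_ge0 ?(ltW r1)//.
by rewrite grid_le// ltnW.
Qed.

(** Bernoulli's inequality gives [m (r - 1) <= r ^ m - 1 = 1/2]. So a shift by [m] grid points costs
    a bounded amount however fine the grid is. *)
Let del_m : del * m%:R <= 1 / 2.
Proof.
have Hm := bernoulli m (ltW r1); rewrite rm in Hm.
apply: (@le_trans _ _ ((r - 1) * m%:R)); first by rewrite ler_wpM2r.
by rewrite mulrC; lra.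
Qed.

Let a i k := if c i + v i <= t k then h i (t k / 2) else 0.

Definition gridQ k := \sum_(i < n) (if c i + v i <= t k then h i (t k / 2) else 0).

Let a_ge0 i k : 0 <= a i k.
Proof. by rewrite /a; case: ifP. Qed.

Let a_le_kap i k : a i k <= kap i.
Proof. by rewrite /a; case: ifP. Qed.

Let a_homo i j k : (j <= k)%N -> a i j <= a i k.
Proof.
move=> jk; have tjk := grid_le jk; rewrite {1}/a; case: ifP => // bj.
by rewrite /a (le_trans bj tjk) h_homo// ler_pM2r// invr_gt0.
Qed.

(** The grid starts below every cost, so no mass is present at index 0. This makes the truncated
    index [k - m] harmless when [k <= m]. *)
Let a0 i : a i 0%N = 0.
Proof.
rewrite /a; case: ifP => // _; rewrite h_le0// /grid expr0 mulr1.
by have := t0c i; have := t00; lra.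
Qed.

Let va_le i k : v i * a i k <= t k * a i k.
Proof.
rewrite /a; case: ifP => [b|_]; last by rewrite !mulr0.
by rewrite ler_wpM2r//; have := hc i; lra.
Qed.

Let Q k := \sum_(i < n) a i k.
Let V k := \sum_(i < n) v i * a i k.
Let Vb := \sum_(i < n) v i * kap i.

Let Q_le1 k : Q k <= 1.
Proof. by apply: le_trans kap1; apply: ler_sum => i _. Qed.

Let Q_ge0 k : 0 <= Q k.
Proof. exact: sumr_ge0. Qed.

Let V_homo j k : (j <= k)%N -> V j <= V k.
Proof. by move=> jk; apply: ler_sum => i _; rewrite ler_wpM2l// a_homo. Qed.

Let V_ge0 k : 0 <= V k.
Proof. by apply: sumr_ge0 => i _; rewrite mulr_ge0. Qed.

Let V_le k : V k <= Vb.
Proof. by apply: ler_sum => i _; rewrite ler_wpM2l. Qed.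

Lemma hazard_ge0 s : 0 <= s -> 0 <= hazard s.
Proof. by move=> s0; apply: sumr_ge0 => i _; exact: Lam_ge0. Qed.

(** Boxes that become active between the two grid points only add to the hazard and are dropped. *)
Let hazardB j k : (j <= k)%N ->
  \sum_(i < n | c i + v i <= t j) (Lam i (t k) - Lam i (t j)) <=
  hazard (t k) - hazard (t j).
Proof.
move=> jk; rewrite sumrB lerB//; rewrite /hazard big_mkcond [leRHS]big_mkcond.
apply: ler_sum => i _; case: ifP => [b|_].
  by rewrite (le_trans b (grid_le jk)).
by case: ifP => // _; apply: Lam_ge0; rewrite ltW// grid_gt0.
Qed.

Lemma surv_gt0 s : 0 < surv s. Proof. exact: expR_gt0. Qed.

Lemma surv_le1 s : 0 <= s -> surv s <= 1.
Proof. by move=> s0; rewrite /surv -expR0 ler_expR oppr_le0 hazard_ge0. Qed.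

Let D i k := Lam i (t k.+1) - Lam i (t k).

Let D_ge0 i k : 0 <= D i k.
Proof. by rewrite subr_ge0 Lam_le ?grid_le// ltW// grid_gt0. Qed.

Let D_ge i k : 2 * del * a i k <= D i k.
Proof.
rewrite /a; case: ifP => _; last by rewrite mulr0.
have := LamB_ge i (grid_gt0 k) (grid_le (leqnSn k)).
have -> // : t k / t k.+1 = r^-1.
by rewrite gridS; field; rewrite !lt0r_neq0// grid_gt0.
Qed.

Let survS k :
  surv (t k.+1) * (1 + \sum_(i < n | c i + v i <= t k) D i k) <= surv (t k).
Proof.
apply: le_trans (_ : surv (t k.+1) * expR (\sum_(i < n | c i + v i <= t k) D i k) <= _).
  by rewrite ler_wpM2l ?(ltW (surv_gt0 _))// expR_ge1Dx.
by rewrite -expRD ler_expR; have := hazardB (leqnSn k); rewrite -/(D _ _); lra.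
Qed.

Let surv_homo k : surv (t k.+1) <= surv (t k).
Proof.
apply: le_trans (survS k); rewrite ler_peMr ?(ltW (surv_gt0 _))// lerDl.
by apply: sumr_ge0.
Qed.

Let sum_telescope (F : nat -> R) K : \sum_(k < K) (F k - F k.+1) = F 0%N - F K.
Proof.
elim: K => [|K IH]; first by rewrite big_ord0 subrr.
by rewrite big_ord_recr /= IH; ring.
Qed.

(** By [survS], a consequence of [1 + x <= exp x], each term is at most the decrease of the survival
    probability over its cell, and the decreases telescope. *)
Let sum_arrival_le1 :
  \sum_(k < N) surv (t k.+1) * \sum_(i < n | c i + v i <= t k) D i k <= 1.
Proof.
apply: (@le_trans _ _ (\sum_(k < N) (surv (t k) - surv (t k.+1)))).
  apply: ler_sum => k _; have := survS k; rewrite mulrDr mulr1; lra.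
rewrite (sum_telescope (fun k => surv (t k))).
have := surv_gt0 (t N); have := surv_le1 (ltW (grid_gt0 0)); lra.
Qed.

(** Only the hazard of the last [m] steps is used. Time grows by the factor 3/2 over them, so
    [LamB_ge] gives the constant [2 (1 - 2/3) = 2/3]. *)
Let surv_le_Q k : surv (t k) <= expR (- (2 / 3 * Q (k - m))).
Proof.
rewrite ler_expR lerN2; case: (leqP k m) => km.
  have -> : (k - m = 0)%N by apply/eqP; rewrite subn_eq0.
  by rewrite /Q big1 ?mulr0 ?hazard_ge0 ?(ltW (grid_gt0 _)).
have le_km : (k - m <= k)%N by exact: leq_subr.
have := hazardB le_km; have := hazard_ge0 (ltW (grid_gt0 (k - m))) => h0 h1.
apply: le_trans (_ : hazard (t k) - hazard (t (k - m)) <= _); last by lra.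
apply: le_trans h1; rewrite mulr_sumr [leRHS]big_mkcond; apply: ler_sum => i _.
rewrite /a; case: ifP => _; last by rewrite mulr0.
have := LamB_ge i (grid_gt0 (k - m)) (grid_le le_km).
have -> : t (k - m) / t k = 2 / 3.
  have e : t k = t (k - m) * (3 / 2).
    by rewrite -rm /grid -mulrA -exprD subnK// ltnW.
  by rewrite e; field; rewrite lt0r_neq0// grid_gt0.
by have -> : 2 * (1 - 2 / 3) = 2 / 3 :> R by field.
Qed.

(** An active box has volume at most [t (k - m) = 2/3 t k]. The ratio 3/2 is the solution [x] of
    [2 (1 - 1/x) = 1/x], so that this constant agrees with the one in [surv_le_Q]. *)
Let V_le_Q k : V (k - m) / t k.+1 <= 2 / 3 * Q (k - m).
Proof.
have tk := grid_gt0 k.+1.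
rewrite ler_pdivrMr//; apply: (@le_trans _ _ (t (k - m) * Q (k - m))).
  by rewrite mulr_sumr; apply: ler_sum => i _; exact: va_le.
case: (leqP k m) => km.
  have -> : (k - m = 0)%N by apply/eqP; rewrite subn_eq0.
  by rewrite /Q big1 ?mulr0// mul0r.
have e : t k = t (k - m) * (3 / 2).
  by rewrite -rm /grid -mulrA -exprD subnK// ltnW.
have := grid_le (leqnSn k); rewrite e => h1.
by rewrite [leRHS]mulrAC; apply: ler_wpM2r => //; lra.
Qed.

Let Ek k := (V k - V (k - m)) / t k.+1.

Let Ek_ge0 k : 0 <= Ek k.
Proof. by rewrite divr_ge0 ?subr_ge0 ?V_homo ?leq_subr// ltW// grid_gt0. Qed.

(** Replace [V k] by [V (k - m)] at the price of [Ek k]. With [x = 2/3 Q (k - m)], the previous two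
    bounds give [S (1 + W) <= exp (- x) (1 + x) <= 1]. *)
Let key k : surv (t k.+1) * ((1 - Q k) * (1 + V k / t k.+1)) <= (1 - Q k) + Ek k.
Proof.
have q1 : 0 <= 1 - Q k by rewrite subr_ge0.
have s1 := surv_le1 (ltW (grid_gt0 k.+1)); have s0 := surv_gt0 (t k.+1).
have E0 := Ek_ge0 k.
have -> : V k / t k.+1 = V (k - m) / t k.+1 + Ek k by rewrite /Ek; ring.
set W := V (k - m) / t k.+1; set S := surv _ in s0 s1 *.
have SW : S * (1 + W) <= 1.
  set x := 2 / 3 * Q (k - m).
  apply: (@le_trans _ _ (expR (- x) * (1 + x))).
    apply: ler_pM; [exact: ltW| | |].
    - rewrite addr_ge0// divr_ge0// ltW// grid_gt0 //.
    - by apply: le_trans (surv_le_Q k); exact: surv_homo.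
    - by rewrite lerD2l; exact: V_le_Q.
  by rewrite expRN mulrC ler_pdivrMr ?expR_gt0// mul1r expR_ge1Dx.
have -> : S * ((1 - Q k) * (1 + (W + Ek k))) =
  (1 - Q k) * (S * (1 + W) + S * Ek k) by ring.
apply: (@le_trans _ _ ((1 - Q k) * (1 + Ek k))).
  by rewrite ler_wpM2l// lerD// ler_piMl.
have := Q_ge0 k; nra.
Qed.

(** Since [dt k / t k.+1 = del] is constant, the sum is [del] times that of [V k - V (k - m)]. This
    splits into [m] unit shifts, each telescoping to at most [Vb], and [del * m <= 1/2]. *)
Let sum_Ek : \sum_(k < N) dt k * Ek k <= Vb / 2.
Proof.
have Vb0 : 0 <= Vb by apply: sumr_ge0 => i _; rewrite mulr_ge0.
have -> : \sum_(k < N) dt k * Ek k = del * \sum_(k < N) (V k - V (k - m)%N).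
  rewrite mulr_sumr; apply: eq_bigr => k _; rewrite dtE /Ek.
  by field; rewrite !lt0r_neq0// grid_gt0.
have step j : \sum_(k < N) (V (k - j)%N - V (k - j.+1)%N) <= Vb.
  case: N => [|K]; first by rewrite big_ord0.
  rewrite big_ord_recl /= !sub0n subrr add0r.
  rewrite (eq_bigr (fun k : 'I_K => - (V (k - j)%N - V (k.+1 - j)%N))); last first.
    by move=> k _; rewrite /bump /= add1n subSS; ring.
  rewrite sumrN (sum_telescope (fun k => V (k - j)%N)) sub0n.
  by have := V_le (K - j)%N; have := V_ge0 0; lra.
have H j : \sum_(k < N) (V k - V (k - j)%N) <= j%:R * Vb.
  elim: j => [|j IH].
    by rewrite big1 ?mul0r// => k _; rewrite subn0 subrr.
  rewrite (eq_bigr (fun k : 'I_N => (V k - V (k - j)%N) + (V (k - j)%N - V (k - j.+1)%N))).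
    by rewrite big_split /= -natr1 mulrDl mul1r lerD.
  by move=> k _; ring.
apply: (@le_trans _ _ (del * (m%:R * Vb))); first by rewrite ler_wpM2l.
rewrite mulrA (le_trans (ler_wpM2r Vb0 del_m))//; lra.
Qed.

Let sum_dt : \sum_(k < N) dt k <= t N.
Proof.
rewrite (eq_bigr (fun k : 'I_N => - (t k - t k.+1))); last by move=> k _; ring.
by rewrite sumrN sum_telescope; have := grid_gt0 0; lra.
Qed.

(** Of the [2 Vb] on the right, one comes from twice [sum_Ek] and one from [arr]. Of the four mesh
    errors, two come from moving the survival probability from [t k] to [t k.+1] and two from
    [t k / t k.+1 = 1 - del]. *)
Lemma grid_inequality :
  2 * \sum_(k < N) dt k * surv (t k)
  - \sum_(k < N) surv (t k.+1) * \sum_(i < n | c i + v i <= t k) (t k - v i) * D i k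
  <= 2 * (\sum_(k < N) dt k * (1 - gridQ k) + Vb) + 4 * ((r - 1) * t N).
Proof.
have Vb0 : 0 <= Vb by apply: sumr_ge0 => i _; rewrite mulr_ge0.
have arr : Vb * \sum_(k < N) surv (t k.+1) * \sum_(i < n | c i + v i <= t k) D i k <= Vb.
  by rewrite ler_piMr.
have step (k : 'I_N) : 2 * (dt k * surv (t k))
    - surv (t k.+1) * \sum_(i < n | c i + v i <= t k) (t k - v i) * D i k
    - Vb * (surv (t k.+1) * \sum_(i < n | c i + v i <= t k) D i k)
    <= 2 * ((r - 1) * t N) * (surv (t k) - surv (t k.+1)) +
       2 * (dt k * (1 - Q k)) + 2 * (dt k * Ek k) + 2 * (del * dt k).
  have S0 := surv_gt0 (t k.+1); have Sk := surv_homo k.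
  have S1 := surv_le1 (ltW (grid_gt0 k.+1)).
  have tk := grid_gt0 k.+1; have d0 := grid_dt_ge0 k.
  have lower : 2 * del * (t k * Q k - V k + Vb * Q k) <=
    \sum_(i < n | c i + v i <= t k) (t k - v i) * D i k +
    Vb * \sum_(i < n | c i + v i <= t k) D i k.
    have -> : t k * Q k - V k + Vb * Q k = \sum_(i < n) (t k - v i + Vb) * a i k.
      rewrite /Q /V !mulr_sumr -sumrB -big_split /=.
      by apply: eq_bigr => i _; ring.
    rewrite !mulr_sumr -big_split /= [leRHS]big_mkcond; apply: ler_sum => i _.
    have := D_ge i k; rewrite /a; case: ifP => [b Dk|_ _]; last by rewrite !mulr0.
    have p : 0 <= t k - v i + Vb by have := hc i; lra.
    by have := ler_wpM2l p Dk; lra.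
  have := key k; set S := surv (t k.+1) in S0 Sk S1 *.
  set y := V k / t k.+1; move=> keyk.
  (* The added [Vb * Q k], paid for by [arr], turns the loss [V k] into [(1 - Q k) * V k] because
     [V k <= Vb]. Then [1 - Q k] factors out and [key] applies. *)
  have b1 : dt k * (t k * Q k - V k + Vb * Q k) / t k.+1 >=
      dt k * (1 - del) * Q k - dt k * ((1 - Q k) * y).
    have -> : 1 - del = t k / t k.+1.
      by rewrite gridS; field; rewrite !lt0r_neq0// grid_gt0.
    rewrite -subr_ge0.
    have -> : dt k * (t k * Q k - V k + Vb * Q k) / t k.+1 -
      (dt k * (t k / t k.+1) * Q k - dt k * ((1 - Q k) * y)) =
      dt k * ((Vb - V k) * Q k) / t k.+1.
      by rewrite /y; field; rewrite lt0r_neq0.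
    apply: divr_ge0; last exact: ltW.
    apply: mulr_ge0 => //; apply: mulr_ge0; last exact: Q_ge0.
    by rewrite subr_ge0 V_le.
  have b2 : 2 * (S * (dt k * (1 - del) * Q k - dt k * ((1 - Q k) * y))) <=
     S * \sum_(i < n | c i + v i <= t k) (t k - v i) * D i k
    + Vb * (S * \sum_(i < n | c i + v i <= t k) D i k).
    have -> : S * \sum_(i < n | c i + v i <= t k) (t k - v i) * D i k
      + Vb * (S * \sum_(i < n | c i + v i <= t k) D i k) =
      S * (\sum_(i < n | c i + v i <= t k) (t k - v i) * D i k +
      Vb * \sum_(i < n | c i + v i <= t k) D i k) by ring.
    rewrite mulrCA ler_wpM2l ?(ltW S0)//; apply: le_trans lower.
    have -> : 2 * del * (t k * Q k - V k + Vb * Q k) =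
      2 * (dt k * (t k * Q k - V k + Vb * Q k) / t k.+1).
      by rewrite dtE; field; rewrite !lt0r_neq0.
    by rewrite ler_pM2l.
  have b3 : dt k * (surv (t k) - S) <= (r - 1) * t N * (surv (t k) - S).
    by rewrite ler_wpM2r ?subr_ge0// grid_dt_le.
  have b4 : dt k * (S * ((1 - Q k) * (1 + y))) <= dt k * (1 - Q k + Ek k).
    by rewrite ler_wpM2l.
  have b5 : S * (dt k * del * Q k) <= del * dt k.
    rewrite (_ : S * _ = del * dt k * (S * Q k)); last by ring.
    by rewrite ler_piMr ?mulr_ge0// mulr_ile1 ?Q_ge0// ltW.
  lra.
have := ler_sum (index_enum 'I_N) (fun k (_ : true) => step k).
rewrite !big_split /= !sumrN -!mulr_sumr (sum_telescope (fun k => surv (t k))).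
rewrite -[\sum_(i < N) dt i * (1 - Q i)]/(\sum_(i < N) dt i * (1 - gridQ i)).
have := sum_Ek; have := sum_dt.
have s0 := surv_le1 (ltW (grid_gt0 0)); have sN := surv_gt0 (t N).
have tN := grid_gt0 N; have rt : 0 <= (r - 1) * t N.
  by apply: mulr_ge0; [rewrite subr_ge0|]; exact: ltW.
have ds : del * \sum_(k < N) dt k <= (r - 1) * t N.
  apply: ler_pM => //; apply: sumr_ge0 => k _; exact: grid_dt_ge0.
have tel : (r - 1) * t N * (surv (t 0%N) - surv (t N)) <= (r - 1) * t N.
  by rewrite ler_piMr//; lra.
move: arr ds tel; lra.
Qed.

End GridInequality.

(** * Comparison of the grid sums with integrals of the shifted mass *)

Section GridIntegral.
Variables (R : realType).
Notation mu := (@lebesgue_measure R).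
Variables (t0 r : R).
Hypothesis t00 : 0 < t0.
Hypothesis r1 : 1 < r.
Notation t := (grid t0 r).
Notation dt k := (t k.+1 - t k).

Lemma sum_grid_dt N : \sum_(k < N) dt k = t N - t 0%N.
Proof.
elim: N => [|N IH]; first by rewrite big_ord0 subrr.
by rewrite big_ord_recr /= IH; ring.
Qed.

Lemma grid_upper_sum (P : R -> R) N : bmeas P -> {homo P : x y / x <= y} ->
  \int[mu]_(x in `[t 0%N, t N]) P x <= \sum_(k < N) dt k * P (t k.+1).
Proof.
move=> bP hP; elim: N => [|N IH].
  by rewrite big_ord0 set_itv1 Rintegral_set1.
have tN : t 0%N <= t N by apply: grid_le.
have tNS : t N <= t N.+1 by apply: grid_le.
rewrite big_ord_recr /= (Rint_chasles bP tN tNS) lerD//.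
have := @Rint_le R P (fun=> P (t N.+1)) (t N) (t N.+1) bP (bmeas_cst _).
rewrite Rint_cst// mulrC; apply => x /andP[_]; exact: hP.
Qed.

(** For a monotone function the right and left sums differ by at most the largest mesh times the
    total increase. *)
Lemma grid_oscillation (P : R -> R) kap N : {homo P : x y / x <= y} ->
  (forall x, 0 <= P x <= kap) ->
  \sum_(k < N) dt k * P (t k.+1) <= \sum_(k < N) dt k * P (t k) + (r - 1) * t N * kap.
Proof.
move=> hP P0; rewrite addrC -lerBlDr -sumrB.
have rt : 0 <= (r - 1) * t N.
  by apply: mulr_ge0; [rewrite subr_ge0 ltW | apply: ltW; apply: grid_gt0].
apply: (@le_trans _ _ (\sum_(k < N) (r - 1) * t N * (P (t k.+1) - P (t k)))).
  apply: ler_sum => k _; rewrite -mulrBr ler_wpM2r//.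
    by rewrite subr_ge0 hP// grid_le.
  exact: grid_dt_le.
rewrite -mulr_sumr ler_wpM2l//.
have -> : \sum_(k < N) (P (t k.+1) - P (t k)) = P (t N) - P (t 0%N).
  elim: (N) => [|K IH]; first by rewrite big_ord0 subrr.
  by rewrite big_ord_recr /= IH; ring.
by have /andP[_] := P0 (t N); have /andP[] := P0 (t 0%N); lra.
Qed.

(** Shifting [h] by [v] loses a final window of length [v], on which [h = kap]; doubled, this is a
    gain of [2 v kap] for the right side. Starting only at [c + v] loses at most [v kap], since [h]
    vanishes on [[0, c/2]]. The difference is the term [v kap]. *)
Lemma grid_box_integral (c v kap : R) (h : R -> R) N :
  t0 <= c -> 0 <= v -> {homo h : x y / x <= y} ->
  (forall x, x <= c -> h x = 0) -> (forall x, h x <= kap) ->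
  h (t N / 2 - v) = kap ->
  2 * \int[mu]_(x in `[0, t N / 2]) h (x - v) + v * kap <=
  \sum_(k < N) dt k * (if c + v <= t k then h (t k / 2) else 0) + (r - 1) * t N * kap.
Proof.
move=> t0c v0 hh h0 hk hL.
have c0 : 0 < c by exact: lt_le_trans t0c.
have hge0 x : 0 <= h x.
  case: (leP x c) => xc; first by rewrite h0.
  by rewrite -(h0 c (lexx c)) hh// ltW.
have kap0 : 0 <= kap by exact: le_trans (hk 0).
have bh : bmeas h by apply: (@nondecreasing_bmeas _ _ kap) => // x; rewrite hge0 hk.
pose P s := if c + v <= s then h (s / 2) else 0.
have hP : {homo P : x y / x <= y}.
  move=> x y xy; rewrite /P; case: ifP => [cx|_]; last by case: ifP.
  by rewrite (le_trans cx xy) hh// ler_pM2r.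
have P0 x : 0 <= P x <= kap by rewrite /P; case: ifP; rewrite ?hge0 ?hk ?lexx ?kap0.
have bP : bmeas P by exact: nondecreasing_bmeas hP P0.
apply: le_trans (grid_oscillation N hP P0).
apply: le_trans (grid_upper_sum N bP hP).
rewrite Rint_shift// sub0r.
have tN := grid_gt0 t00 r1 N.
have tN0 : t 0%N = t0 by rewrite /grid expr0 mulr1.
(* If [kap = 0] then [h] is zero. Otherwise [h (t N / 2 - v) = kap > 0] forces [c < t N / 2 - v],
   which puts the cut points below in order. *)
have [k0|kp] := leP kap 0.
  have hz x : h x = 0 by apply: le_anti; rewrite hge0 (le_trans (hk x)).
  have -> : kap = 0 by apply: le_anti; rewrite k0 kap0.
  rewrite (@eq_Rint R h (fun=> 0)) ?Rintegral_cst// !mul0r !mulr0 addr0.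
  by apply: Rintegral_ge0 => x _; case/andP: (P0 x).
have Lc : c < t N / 2 - v.
  by rewrite ltNge; apply/negP => /h0; rewrite hL => k0; rewrite k0 ltxx in kp.
rewrite tN0 (Rint_chasles bP (b := c + v)); [|by lra|by lra].
have I1 : 0 <= \int[mu]_(x in `[t0, c + v]) P x.
  by apply: Rintegral_ge0 => x _; case/andP: (P0 x).
have -> : \int[mu]_(x in `[c + v, t N]) P x =
    2 * \int[mu]_(x in `[(c + v) / 2, t N / 2]) h x.
  have := @Rint_affine R h 2^-1 0 (c + v) (t N) _ bh hge0.
  rewrite invr_gt0 invrK !addr0 (mulrC _ (c + v)) (mulrC _ (t N)) => /(_ (ltr0n _ 2)) <-.
  apply: eq_Rint => x /andP[xc _]; by rewrite /P xc addr0 mulrC.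
have e1 : \int[mu]_(x in `[- v, t N / 2 - v]) h x = \int[mu]_(x in `[0, t N / 2 - v]) h x.
  rewrite (Rint_chasles bh (a := - v) (b := 0)) ?oppr_le0//; last by lra.
  rewrite (@eq_Rint R h (fun=> 0) (- v) 0) ?Rint_cst ?oppr_le0// ?mul0r ?add0r//.
  by move=> x /andP[_ x0]; rewrite h0//; lra.
have e2 : \int[mu]_(x in `[0, t N / 2]) h x =
    \int[mu]_(x in `[0, t N / 2 - v]) h x + kap * v.
  rewrite (Rint_chasles bh (b := t N / 2 - v)); [|by lra|by lra]; congr +%R.
  rewrite (@eq_Rint R h (fun=> kap)); first by rewrite Rint_cst; [congr *%R|]; lra.
  by move=> x /andP[Lx _]; apply: le_anti; rewrite hk -hL hh.
have e3 : \int[mu]_(x in `[0, t N / 2]) h x =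
    \int[mu]_(x in `[0, (c + v) / 2]) h x + \int[mu]_(x in `[(c + v) / 2, t N / 2]) h x.
  by rewrite (Rint_chasles bh (b := (c + v) / 2)) //; lra.
(* [h] vanishes on [[0, c/2]]. *)
have e4 : \int[mu]_(x in `[0, (c + v) / 2]) h x <= kap * (v / 2).
  rewrite (Rint_chasles bh (b := c / 2)); [|by lra|by lra].
  rewrite (@eq_Rint R h (fun=> 0) 0 (c / 2)); last first.
    by move=> x /andP[_ x0]; rewrite h0//; lra.
  rewrite Rint_cst ?mul0r ?add0r; last by lra.
  have := @Rint_le R h (fun=> kap) (c / 2) ((c + v) / 2) bh (bmeas_cst _) (fun x _ => hk x).
  by rewrite Rint_cst; [rewrite (_ : (c + v) / 2 - c / 2 = v / 2) //|]; lra.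
rewrite e1; move: e2 e3 e4 I1; lra.
Qed.

Variables (n : nat) (c v kap : 'I_n -> R) (h : 'I_n -> R -> R).
Hypothesis t0c : forall i, t0 <= c i.
Hypothesis hv : forall i, 0 <= v i.
Hypothesis h_homo : forall i, {homo h i : s t / s <= t}.
Hypothesis h_le0 : forall i t, t <= c i -> h i t = 0.
Hypothesis h_kap : forall i t, h i t <= kap i.
Hypothesis kap1 : \sum_(i < n) kap i <= 1.

Lemma grid_sum_le_integral N : (forall i, h i (t N / 2 - v i) = kap i) ->
  \sum_(k < N) dt k * (1 - gridQ c v h t0 r k) + \sum_(i < n) v i * kap i <=
  2 * \int[mu]_(x in `[0, t N / 2]) (1 - \sum_(i < n) h i (x - v i)) + (r - 1) * t N.
Proof.
move=> hL.
have tN := grid_gt0 t00 r1 N.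
have hge0 i x : 0 <= h i x.
  case: (leP x (c i)) => xc; first by rewrite h_le0.
  by rewrite -(h_le0 (lexx (c i))) h_homo// ltW.
have bh i : bmeas (fun x => h i (x - v i)).
  apply: (@bmeas_comp _ (h i)); last first.
    by apply: measurable_funB => //; exact: measurable_cst.
  apply: (@nondecreasing_bmeas _ _ (kap i)) => [|x]; first exact: h_homo.
  by rewrite hge0 h_kap.
have H := ler_sum (index_enum 'I_n) (fun i (_ : true) =>
  grid_box_integral (t0c i) (hv i) (@h_homo i) (@h_le0 i) (h_kap i) (hL i)).
rewrite !big_split /= -!mulr_sumr exchange_big /= in H.
rewrite RintegralB//; first last.
- by apply: bmeas_integrable; apply: bmeas_sum.
- by apply: bmeas_integrable; exact: bmeas_cst.
rewrite Rint_cst ?divr_ge0 ?(ltW tN)// Rint_sum//.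
have -> : \sum_(k < N) dt k * (1 - gridQ c v h t0 r k) =
   t N - t 0%N - \sum_(k < N) \sum_(i < n) dt k * (if c i + v i <= t k then h i (t k / 2) else 0).
  rewrite -sum_grid_dt -sumrB; apply: eq_bigr => k _.
  by rewrite /gridQ mulrBr mulr1 mulr_sumr.
have rt : (r - 1) * t N * \sum_(i < n) kap i <= (r - 1) * t N.
  by rewrite ler_piMr// mulr_ge0 ?(ltW tN)// subr_ge0 ltW.
have t0p := grid_gt0 t00 r1 0.
lra.
Qed.

End GridIntegral.

(** * Truncation of a feasible solution to total mass at most 1 *)

Section Truncation.
Variables (R : realType) (n : nat) (c v : 'I_n -> R) (X : 'I_n -> R -> R).
Notation mu := (@lebesgue_measure R).
Hypothesis hc : forall i, 0 < c i.
Hypothesis hv : forall i, 0 <= v i.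
Hypothesis hX : cp_feasible c X.

Definition served (x : R) := \sum_(i < n) Xpos X i (x - v i - c i).

Lemma served_homo : {homo served : x y / x <= y}.
Proof. by move=> x y xy; apply: ler_sum => i _; rewrite (Xpos_homo hX)// !lerD2r. Qed.

Lemma served_bmeas : bmeas served.
Proof.
apply: (@nondecreasing_bmeas _ _ n%:R); first exact: served_homo.
move=> x; rewrite sumr_ge0 => [|i _]; last by case/andP: (Xpos_bounds hX i (x - v i - c i)).
rewrite -[n in n%:R]card_ord -sumr_const; apply: ler_sum => i _.
by case/andP: (Xpos_bounds hX i (x - v i - c i)).
Qed.

(** The integrand of the program's objective in the scenario [v]. *)
Definition unserved (x : R) := Num.max (1 - served x) 0.

Lemma unserved_bmeas : bmeas unserved.
Proof.
split.
  apply: measurable_maxr; last exact: measurable_cst.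
  by apply: measurable_funB; [exact: measurable_cst | exact: served_bmeas.1].
exists 1 => x; rewrite ger0_norm ?le_max ?lexx ?orbT// ge_max ler01 andbT gerBl.
by apply: sumr_ge0 => i _; case/andP: (Xpos_bounds hX i (x - v i - c i)).
Qed.

(* Capping each box at the time when the served mass reaches 1; a jump of the
   served mass across the level 1 is split by mixing two caps. *)
Let capped s0 s1 th i x :=
  (1 - th) * Xpos X i (Num.min x (s0 - v i) - c i) + th * Xpos X i (Num.min x (s1 - v i) - c i).

(** The caps are shifted by the volumes, so after the shift by [v i] all boxes are frozen at the
    same time. *)
Let sum_capped s0 s1 th x : \sum_(i < n) capped s0 s1 th i (x - v i) =
  (1 - th) * served (Num.min x s0) + th * served (Num.min x s1).
Proof.
rewrite /served !mulr_sumr -big_split /=; apply: eq_bigr => i _; rewrite /capped.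
by rewrite -!addr_minl.
Qed.

Let capped_props s0 s1 th L : 0 <= th <= 1 -> s0 <= s1 -> s1 <= L ->
  [/\ forall i, {homo capped s0 s1 th i : x y / x <= y},
      forall i x, x <= c i -> capped s0 s1 th i x = 0,
      forall i x, capped s0 s1 th i x <= Xpos X i (x - c i),
      forall i x, capped s0 s1 th i x <= capped s0 s1 th i (L - v i) &
      \sum_(i < n) capped s0 s1 th i (L - v i) = (1 - th) * served s0 + th * served s1].
Proof.
move=> /andP[th0 th1] s01 s1L; have th1' : 0 <= 1 - th by rewrite subr_ge0.
have mono i : {homo capped s0 s1 th i : x y / x <= y}.
  move=> x y xy; apply: lerD; rewrite ler_wpM2l// (Xpos_homo hX)// lerD2r;
  by rewrite le_min !ge_min xy lexx orbT.
split => //.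
- move=> i x xc; rewrite /capped !(Xpos_le0 hX) ?mulr0 ?addr0// subr_le0 ge_min xc //.
- move=> i x; apply: (@le_trans _ _ ((1 - th) * Xpos X i (x - c i) + th * Xpos X i (x - c i))).
    by apply: lerD; rewrite ler_wpM2l// (Xpos_homo hX)// lerD2r ge_min lexx.
  by rewrite -mulrDl subrK mul1r.
- move=> i x; rewrite /capped (min_r (x := L - v i) (y := s0 - v i)) ?lerD2r ?(le_trans s01)//.
  rewrite (min_r (x := L - v i) (y := s1 - v i)) ?lerD2r//.
  by apply: lerD; rewrite ler_wpM2l// (Xpos_homo hX)// lerD2r ge_min lexx orbT.
- by rewrite sum_capped !min_r// (le_trans s01).
Qed.

Let served0 : served 0 = 0.
Proof.
by rewrite /served big1// => i _; rewrite (Xpos_le0 hX)//; have := hc i; have := hv i; lra.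
Qed.

(** The served mass may jump over the level 1. On a uniform partition of mesh at most [e], take the
    first point above the level and its predecessor. *)
Lemma crossing (L e : R) : 0 < L -> 0 < e -> 1 < served L ->
  exists s0 s1, [/\ 0 <= s0, s0 <= s1, s1 <= L, s1 - s0 <= e & served s0 <= 1 < served s1].
Proof.
move=> L0 e0 fL.
pose K := (Num.truncn (L / e)).+1.
have Kp : 0 < K%:R :> R by rewrite ltr0n.
have LK : L / K%:R <= e.
  by rewrite ler_pdivrMr// mulrC -ler_pdivrMr// ltW// truncnS_gt.
have ex : exists k : nat, 1 < served (L / K%:R * k%:R).
  by exists K; rewrite divfK// lt0r_neq0.
case: (ex_minnP ex) => -[|k] fk kmin.
  by rewrite mulr0 served0 ltr10 in fk.
have LK0 : 0 <= L / K%:R by rewrite divr_ge0// ltW.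
exists (L / K%:R * k%:R), (L / K%:R * k.+1%:R); split.
- by rewrite mulr_ge0.
- by rewrite ler_wpM2l// ler_nat.
- rewrite -[leRHS](@divfK _ K%:R) ?lt0r_neq0// ler_wpM2l// ler_nat.
  by apply: kmin; rewrite divfK// lt0r_neq0.
- by rewrite -mulrBr -natr1 addrAC subrr add0r mulr1.
- rewrite fk andbT leNgt; apply/negP => /kmin; by rewrite ltnn.
Qed.

(** If the served mass stays at most 1, cap at [L]. Otherwise mix the caps at [s0] and [s1] with the
    weight that makes the final mass 1: up to [s0] the mass is unchanged, from [s1] on nothing is
    left unserved, and in between the loss is at most [s1 - s0 <= e]. *)
Lemma truncation (L e : R) : 0 < L -> 0 < e -> exists h : 'I_n -> R -> R,
  [/\ (forall i, {homo h i : x y / x <= y}),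
      (forall i x, x <= c i -> h i x = 0),
      (forall i x, h i x <= Xpos X i (x - c i)) &
      (forall i x, h i x <= h i (L - v i))] /\
  [/\ \sum_(i < n) h i (L - v i) <= 1 &
      \int[mu]_(x in `[0, L]) (1 - \sum_(i < n) h i (x - v i)) <=
      \int[mu]_(x in `[0, L]) unserved x + e].
Proof.
move=> L0 e0.
have aux (A B C A' B' C' x : R) : A <= A' -> B <= x -> C <= C' -> 0 <= B' -> x <= e ->
  A + (B + C) <= A' + (B' + C') + e by lra.
case: (leP (served L) 1) => fL.
  have h01 : 0 <= (0 : R) <= 1 by rewrite lexx ler01.
  have [p1 p2 p3 p4 p5] := capped_props h01 (lexx L) (lexx L).
  exists (capped L L 0); split => //; split; first by rewrite p5; lra.
  rewrite -[leLHS]addr0; apply: lerD; last exact: ltW.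
  rewrite (@eq_Rint R _ (fun x => 1 - served x)); last first.
    move=> x /andP[_ xL]; rewrite sum_capped min_l//; ring.
  apply: Rint_le; last by move=> x _; rewrite /unserved le_max lexx.
    by apply: bmeasB; [exact: bmeas_cst | exact: served_bmeas].
  exact: unserved_bmeas.
have [s0 [s1 [s00 s01 s1L se /andP[f0 f1]]]] := crossing L0 e0 fL.
pose th := (1 - served s0) / (served s1 - served s0).
have d0 : 0 < served s1 - served s0 by lra.
have th01 : 0 <= th <= 1.
  apply/andP; split; first by apply: divr_ge0; [rewrite subr_ge0 | exact: ltW].
  by rewrite ler_pdivrMr// mul1r lerD2r ltW.
have mix : (1 - th) * served s0 + th * served s1 = 1.
  by rewrite /th; field; rewrite lt0r_neq0.
have [p1 p2 p3 p4 p5] := @capped_props s0 s1 th L th01 s01 s1L.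
exists (capped s0 s1 th); split => //; split; first by rewrite p5 mix.
pose F x := 1 - ((1 - th) * served (Num.min x s0) + th * served (Num.min x s1)).
have mmin s : measurable_fun setT (fun x : R => Num.min x s).
  by apply: measurable_minr => //; exact: measurable_cst.
have bF : bmeas F.
  apply: bmeasB; first exact: bmeas_cst.
  apply: bmeasD; apply: bmeasM; try exact: bmeas_cst.
    exact: (bmeas_comp served_bmeas (mmin s0)).
  exact: (bmeas_comp served_bmeas (mmin s1)).
rewrite (@eq_Rint R _ F); last by move=> x _; rewrite sum_capped.
have bU := unserved_bmeas.
have U0 x : 0 <= unserved x by rewrite /unserved le_max lexx orbT.
have s0L := le_trans s01 s1L.
rewrite (Rint_chasles bF s00 s0L) (Rint_chasles bF s01 s1L).
rewrite (Rint_chasles bU s00 s0L) (Rint_chasles bU s01 s1L).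
have i1 : \int[mu]_(x in `[0, s0]) F x <= \int[mu]_(x in `[0, s0]) unserved x.
  apply: Rint_le => // x /andP[_ xs]; rewrite /F /unserved le_max.
  by rewrite !min_l// ?(le_trans xs)// -mulrDl subrK mul1r lexx.
have i3 : \int[mu]_(x in `[s1, L]) F x <= \int[mu]_(x in `[s1, L]) unserved x.
  apply: Rint_le => // x /andP[xs _]; rewrite /F.
  by rewrite !min_r// ?(le_trans s01)// mix subrr.
have i2 : \int[mu]_(x in `[s0, s1]) F x <= s1 - s0.
  have := @Rint_le R F (fun=> 1) s0 s1 bF (bmeas_cst _).
  rewrite Rint_cst// mul1r; apply => x _; rewrite /F gerBl.
  have sge0 y : 0 <= served y.
    by apply: sumr_ge0 => i _; case/andP: (Xpos_bounds hX i (y - v i - c i)).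
  case/andP: th01 => ? ?; by rewrite addr_ge0// mulr_ge0// subr_ge0.
have i4 : 0 <= \int[mu]_(x in `[s0, s1]) unserved x by apply: Rintegral_ge0.
exact: aux i1 i2 i3 i4 se.
Qed.

End Truncation.

(** * A pathwise bound on the cost by events of the grid *)

Section Pathwise.
Variables (R : realType) (n : nat) (c v : 'I_n -> R).
Hypothesis hc : forall i, 0 < c i.
Hypothesis hv : forall i, 0 <= v i.
Implicit Type a : 'I_n -> \bar R.

Notation tau a i := (Order.max (a i) (c i + v i)%:E).

Lemma tau_star_le a i : (tau_star c v a <= tau a i)%E.
Proof. exact: bigmin_le. Qed.

Lemma lt_tau_star a (x : R) :
  (x%:E < tau_star c v a)%E = [forall i, (x%:E < tau a i)%E].
Proof.
apply/idP/forallP => [h i|h]; first exact: lt_le_trans h (tau_star_le a i).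
by apply/bigmin_gtP; split => [|i _]; rewrite ?ltry.
Qed.

Lemma tau_star_attained a : (tau_star c v a < +oo)%E ->
  exists i, tau_star c v a = tau a i.
Proof.
move=> ts; case: (pickP (fun _ : 'I_n => true)) => [i0 _|no]; last first.
  by move: ts; rewrite /tau_star big_pred0 ?ltxx.
have [|i _ e] := @eq_bigmin _ _ _ +oo%E i0 predT (fun i => tau a i) isT.
  by move=> i _; exact: leey.
by exists i.
Qed.

(* Box [i] arrives in [(x, y]] while no other box has stopped the process by [s]. *)
Definition lone_arrival (i : 'I_n) (x y s : R) a : bool :=
  [&& (x%:E < a i)%E, (a i <= y%:E)%E &
   [forall j, (j != i) ==> (s%:E < Order.max (a j) (c j + v j)%:E)%E]].

Variables (t0 r : R) (N : nat).
Hypothesis t00 : 0 < t0.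
Hypothesis r1 : 1 < r.
Notation t := (grid t0 r).
Notation dt k := (t k.+1 - t k).

(** The general bound on the volume taken is [tau_star]. If box [i] stops the process by arriving
    after [c i + v i], the bound improves to [v i], and [t k - v i] records this gain. *)
Definition saving a := \sum_(k < N) \sum_(i < n | c i + v i <= t k)
  (t k - v i) * (lone_arrival i (t k) (t k.+1) (t k.+1) a)%:R.

(** Box [j] is left out of its own survival condition, so that the probability of each event factors
    over the boxes. Arrivals up to [t0] precede the grid and are all charged. *)
Definition opening_bound a := \sum_(j < n) c j * (a j <= t0%:E)%E%:R +
  \sum_(k < N) \sum_(j < n) c j * (lone_arrival j (t k) (t k.+1) (t k) a)%:R.

Definition time_bound a := t0 + \sum_(k < N) dt k * ((t k)%:E < tau_star c v a)%E%:R.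

Lemma opening_bound_ge a : (tau_star c v a <= (t N)%:E)%E ->
  \sum_(j < n) c j * (a j <= tau_star c v a)%E%:R <= opening_bound a.
Proof.
set ts := tau_star c v a => tsN.
rewrite /opening_bound exchange_big -big_split /=; apply: ler_sum => j _.
rewrite -mulr_sumr -mulrDr ler_wpM2l ?(ltW (hc j))//.
case: (leP (a j) ts) => [ajts|_] /=; last first.
  by apply: addr_ge0; [|apply: sumr_ge0].
case: (leP (a j) t0%:E) => [_|ajt0] /=; first by rewrite lerDl sumr_ge0.
rewrite add0r.
have [k [kN tk tk1]] : exists k, [/\ (k < N)%N, ((t k)%:E < a j)%E & (a j <= (t k.+1)%:E)%E].
  have : (a j <= (t N)%:E)%E by exact: le_trans tsN.
  elim: (N) => [|K IH]; first by rewrite /grid expr0 mulr1 leNgt ajt0.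
  case: (leP (a j) (t K)%:E) => [/IH[k [kK ? ?]] _|? ?].
    by exists k; split => //; exact: ltnW.
  by exists K.
rewrite (bigD1 (Ordinal kN)) //= (_ : lone_arrival _ _ _ _ _) ?lerDl ?sumr_ge0//.
rewrite /lone_arrival tk tk1 /=; apply/forallP => l; apply/implyP => _.
by apply: lt_le_trans tk (le_trans ajts _); exact: tau_star_le.
Qed.

(** The bound is [tau_star] rounded up to the next grid point, since the indicators are 1 exactly on
    the cells that start before it. *)
Lemma time_bound_ge a : (tau_star c v a <= (t N)%:E)%E ->
  (tau_star c v a <= (time_bound a)%:E)%E.
Proof.
rewrite /time_bound; set ts := tau_star c v a.
elim: (N) => [|K IH].
  by rewrite /grid expr0 mulr1 big_ord0 addr0.
case: (leP ts (t K)%:E) => [/IH h _|tK tsK].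
  apply: le_trans h _; rewrite lee_fin lerD2l big_ord_recr /= lerDl.
  by rewrite mulr_ge0// grid_dt_ge0.
rewrite (_ : t0 + _ = t K.+1) //.
rewrite (eq_bigr (fun k : 'I_K.+1 => dt k)) ?sum_grid_dt.
  have -> : t 0%N = t0 by rewrite /grid expr0 mulr1.
  by rewrite addrC subrK.
move=> k _; rewrite (le_lt_trans _ tK) ?mulr1// lee_fin grid_le//.
by rewrite -ltnS.
Qed.

(** Two lone arrivals of different boxes would each have to precede the other, and one box arrives
    in a single cell. So at most one term is nonzero, and its box is the one that stops the
    process. *)
Lemma saving_cases a :
  saving a = 0 /\ (forall k i, (k < N)%N -> c i + v i <= t k ->
                    lone_arrival i (t k) (t k.+1) (t k.+1) a = false)
  \/ exists k i, [/\ (k < N)%N, tau_star c v a = a i, (a i <= (t k.+1)%:E)%E,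
       ((t k)%:E < a i)%E & saving a = t k - v i].
Proof.
case: (pselect (exists k i, [/\ (k < N)%N, c i + v i <= t k &
    lone_arrival i (t k) (t k.+1) (t k.+1) a])) => [[k [i [kN b U]]]|no]; last first.
  have H k i : (k < N)%N -> c i + v i <= t k ->
      lone_arrival i (t k) (t k.+1) (t k.+1) a = false.
    by move=> kN b; apply/negP => U; apply: no; exists k, i.
  left; split => //; rewrite /saving big1// => k _; rewrite big1// => i b.
  by rewrite H// mulr0.
right; exists k, i; move: (U) => /and3P[tk tk1 /forallP others].
have taui : tau a i = a i.
  by apply/max_idPl/ltW; apply: le_lt_trans tk; rewrite lee_fin.
have tsE : tau_star c v a = a i.
  apply/le_anti/andP; split; first by rewrite -taui; exact: tau_star_le.
  apply/bigmin_geP; split => [|j _]; first exact: leey.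
  have [->|ji] := eqVneq j i; first by rewrite taui.
  by apply: le_trans tk1 (ltW _); have := others j; rewrite ji.
split => //.
have uniq k' i' : (k' < N)%N -> c i' + v i' <= t k' ->
    lone_arrival i' (t k') (t k'.+1) (t k'.+1) a -> i' = i /\ k' = k.
  move=> k'N b' /and3P[tk' tk1' /forallP others'].
  have taui' : tau a i' = a i'.
    by apply/max_idPl/ltW; apply: le_lt_trans tk'; rewrite lee_fin.
  have ii : i' = i.
    apply/eqP; apply/negPn/negP => ne.
    have := others i'; rewrite ne /= taui' => h1.
    have := others' i; rewrite eq_sym ne /= taui => h2.
    by have := lt_le_trans (le_lt_trans tk1 h1) (le_trans tk1' (ltW h2)); rewrite ltxx.
  split=> //; rewrite ii in tk' tk1'; apply/eqP; rewrite eqn_leq.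
  apply/andP; split; rewrite leqNgt; apply/negP => lt.
    have := lt_le_trans tk' tk1; rewrite lte_fin ltNge.
    by rewrite grid_le.
  have := lt_le_trans tk tk1'; rewrite lte_fin ltNge.
  by rewrite grid_le.
rewrite /saving (bigD1 (Ordinal kN)) //= [X in _ + X]big1 ?addr0; last first.
  move=> k' nk; rewrite big1// => i' b'.
  case: (boolP (lone_arrival _ _ _ _ _)) => [U'|]; last by rewrite mulr0.
  have [_ kk] := uniq _ _ (ltn_ord k') b' U'.
  by move: nk; rewrite -val_eqE /= kk eqxx.
rewrite (bigD1 i) //= U mulr1 [X in _ + X]big1 ?addr0// => i' /andP[b' ni].
case: (boolP (lone_arrival _ _ _ _ _)) => [U'|]; last by rewrite mulr0.
have [ii _] := uniq _ _ kN b' U'.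
by move: ni; rewrite ii eqxx.
Qed.

Lemma opening_bound_ge0 a : 0 <= opening_bound a.
Proof.
apply: addr_ge0; [apply: sumr_ge0 => j _ |
  apply: sumr_ge0 => k _; apply: sumr_ge0 => j _]; by rewrite mulr_ge0// ltW.
Qed.

Lemma time_bound_ge0 a : 0 <= time_bound a.
Proof.
apply: addr_ge0; first exact: ltW.
by apply: sumr_ge0 => k _; rewrite mulr_ge0// grid_dt_ge0.
Qed.

(** Needed on paths that have not stopped by [t N]: there the truncated cost is 0 and the bound must
    still be nonnegative. *)
Lemma saving_le a : saving a <= opening_bound a + time_bound a.
Proof.
have o := opening_bound_ge0 a; case: (saving_cases a) => [[-> _]|].
  by rewrite addr_ge0// time_bound_ge0.
move=> [k [i [kN tsE ai tk ->]]].
have : (tau_star c v a <= (t N)%:E)%E.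
  by rewrite tsE; apply: le_trans ai _; rewrite lee_fin grid_le.
move=> /time_bound_ge; rewrite tsE => h.
have := lt_le_trans tk h; rewrite lte_fin; have := hv i; lra.
Qed.

Lemma bs_cost_le_open a i : (tau_star c v a < +oo)%E -> (a i <= tau_star c v a)%E ->
  (bs_cost c v a <= (\sum_(j < n) c j * (a j <= tau_star c v a)%E%:R + v i)%:E)%E.
Proof.
move=> ts ai; rewrite /bs_cost lt_eqF// EFinD; apply: leeD.
  rewrite big_mkcond -sumEFin; apply: lee_sum => j _.
  by case: ifP => _; rewrite ?mulr1 ?mulr0.
exact: (bigmin_le_cond +oo%E (fun j => (v j)%:E) ai).
Qed.

(** Without a saving, the stopping box has [v i <= c i + v i <= tau_star]. With one,
    [v i = t k - (t k - v i)] and [t k] is at most the time bound. *)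
Lemma bs_cost_pathwise a : (tau_star c v a <= (t N)%:E)%E ->
  (bs_cost c v a <= (opening_bound a + time_bound a - saving a)%:E)%E.
Proof.
move=> tsN; have op := opening_bound_ge tsN; have tm := time_bound_ge tsN.
have tsy : (tau_star c v a < +oo)%E by apply: le_lt_trans tsN _; exact: ltry.
case: (saving_cases a) => [[-> _]|[k [i [kN tsE ai tk ->]]]].
  have [i ie] := tau_star_attained tsy.
  have ai : (a i <= tau_star c v a)%E by rewrite ie le_max lexx.
  apply: le_trans (bs_cost_le_open tsy ai) _; rewrite lee_fin subr0 lerD//.
  rewrite -lee_fin; apply: le_trans tm; rewrite ie le_max; apply/orP; right.
  by rewrite lee_fin lerDr ltW.
have ai' : (a i <= tau_star c v a)%E by rewrite tsE.
apply: le_trans (bs_cost_le_open tsy ai') _; rewrite lee_fin.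
have : t k <= time_bound a by rewrite -lee_fin; apply: le_trans tm; rewrite tsE ltW.
lra.
Qed.

Lemma bs_cost_ge0 a : (0 <= bs_cost c v a)%E.
Proof.
rewrite /bs_cost; case: ifP => // _; apply: adde_ge0.
  by apply: sume_ge0 => j _; rewrite lee_fin ltW.
by apply/bigmin_geP; split => [|i _]; rewrite ?leey ?lee_fin.
Qed.

Lemma bs_cost_le_total a : (tau_star c v a < +oo)%E ->
  (bs_cost c v a <= (\sum_(j < n) (c j + v j))%:E)%E.
Proof.
move=> ts; have [i ie] := tau_star_attained ts.
have ai : (a i <= tau_star c v a)%E by rewrite ie le_max lexx.
apply: le_trans (bs_cost_le_open ts ai) _; rewrite lee_fin big_split /= lerD//.
  by apply: ler_sum => j _; case: (_ <= _)%E; rewrite ?mulr1 ?mulr0// ltW.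
by rewrite (bigD1 i)//= lerDl sumr_ge0.
Qed.

End Pathwise.

(** * Measurability of the stopping time and of the cost *)

Lemma measurable_bigmine (R : realType) d (T : measurableType d) (n : nat)
    (F : 'I_n -> T -> \bar R) : (forall i, measurable_fun setT (F i)) ->
  measurable_fun setT (fun w => \big[Order.min/+oo%E]_(i < n) F i w).
Proof.
elim: n F => [|n IH] F mF.
  by under eq_fun do rewrite big_ord0; exact: measurable_cst.
under eq_fun do rewrite big_ord_recl.
by apply: measurable_mine => //; apply: IH.
Qed.

Lemma measurable_tau_star (R : realType) (n : nat) (c : 'I_n -> R) d
    (T : measurableType d) (v : 'I_n -> T -> R) (a : 'I_n -> T -> \bar R) :
  (forall i, measurable_fun setT (v i)) -> (forall i, measurable_fun setT (a i)) ->
  measurable_fun setT (fun w => tau_star c (v^~ w) (a^~ w)).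
Proof.
move=> mv ma; apply: measurable_bigmine => i; apply: measurable_maxe => //.
apply/measurable_EFinP; apply: measurable_funD => //; exact: measurable_cst.
Qed.

Lemma measurable_bs_cost (R : realType) (n : nat) (c : 'I_n -> R) d
    (T : measurableType d) (v : 'I_n -> T -> R) (a : 'I_n -> T -> \bar R) :
  (forall i, measurable_fun setT (v i)) -> (forall i, measurable_fun setT (a i)) ->
  measurable_fun setT (fun w => bs_cost c (v^~ w) (a^~ w)).
Proof.
move=> mv ma; have mt := measurable_tau_star c mv ma.
rewrite /bs_cost; apply: measurable_fun_ifT; [|exact: measurable_cst|].
  by apply: measurable_fun_eqe => //; exact: measurable_cst.
have mle j : measurable_fun setT (fun w => a j w <= tau_star c (v^~ w) (a^~ w))%E.
  exact: measurable_fun_lee.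
apply: emeasurable_funD.
  under eq_fun do rewrite big_mkcond.
  apply: emeasurable_sum => j; apply: measurable_fun_ifT => //; exact: measurable_cst.
under eq_fun do rewrite bigmin_mkcond.
apply: measurable_bigmine => j; apply: measurable_fun_ifT => //.
by apply/measurable_EFinP.
Qed.

(** * Means of integrable random variables *)

Section Means.
Variables (R : realType) (d : measure_display) (T : measurableType d).
Variable P : probability T R.

(** Integrability and value are kept together, so that linear combinations of indicators are
    integrated without separate finiteness conditions. *)
Definition has_mean (f : T -> R) (x : R) :=
  P.-integrable setT (EFin \o f) /\ (\int[P]_w (f w)%:E)%E = x%:E.

Lemma has_meanD f g x y : has_mean f x -> has_mean g y ->
  has_mean (fun w => f w + g w) (x + y).
Proof.
move=> [If Ef] [Ig Eg]; split; first exact: (integrableD _ If Ig).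
by have := integralD_EFin (measurableT : measurable [set: T]) If Ig;
  rewrite [in X in _ = X]/= Ef Eg EFinD.
Qed.

Lemma has_meanZ k f x : has_mean f x -> has_mean (fun w => k * f w) (k * x).
Proof.
move=> [If Ef]; split; first exact: (integrableZl _ k If).
by have := integralZl (measurableT : measurable [set: T]) If k;
  rewrite [in X in _ = X]/= Ef -EFinM.
Qed.

Lemma has_mean_cst k : has_mean (fun=> k) k.
Proof.
split; first by apply: finite_measure_integrable_cst.
rewrite integral_cst//.
have PT : P setT = 1%E by exact: probability_setT.
by rewrite -[RHS]mule1 -PT.
Qed.

Lemma has_meanB f g x y : has_mean f x -> has_mean g y ->
  has_mean (fun w => f w - g w) (x - y).
Proof.
move=> hf hg; have := has_meanD hf (has_meanZ (-1) hg); rewrite mulN1r.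
by under eq_fun do rewrite mulN1r.
Qed.

Lemma has_mean_sum (I : Type) (s : seq I) (p : pred I) F (x : I -> R) :
  (forall i, has_mean (F i) (x i)) ->
  has_mean (fun w => \sum_(i <- s | p i) F i w) (\sum_(i <- s | p i) x i).
Proof.
move=> hF; elim: s => [|i s IH].
  by under eq_fun do rewrite big_nil; rewrite big_nil; exact: has_mean_cst.
under eq_fun do rewrite big_cons; rewrite big_cons; case: (p i) => //.
exact: has_meanD.
Qed.

Lemma has_mean_bool (b : T -> bool) r : measurable [set w | b w] ->
  P [set w | b w] = r%:E -> has_mean (fun w => (b w)%:R) r.
Proof.
move=> mb Pb; have e : (fun w => (b w)%:R) = \1_[set w | b w] :> (T -> R).
  by apply/funext => w; rewrite indicE; case: (boolP (b w)) => h;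
    [rewrite mem_set | rewrite memNset//; apply/negP].
split.
  rewrite e; apply: measurable_bounded_integrable => //.
    by apply: le_lt_trans (probability_le1 P measurableT) _; exact: ltry.
  exists 1; split => // x x1 w _ /=; rewrite indicE; case: (_ \in _) => /=.
    by rewrite normr1 ltW.
  by rewrite normr0 ltW// (lt_trans ltr01).
have -> : (\int[P]_w (b w)%:R%:E = \int[P]_w (\1_[set w | b w] w)%:E)%E.
  by apply: eq_integral => w _; rewrite -e.
by rewrite integral_indic// setIT; exact: Pb.
Qed.

Lemma le_has_mean (g : T -> \bar R) f x : measurable_fun setT g ->
  (forall w, (0 <= g w)%E) -> (forall w, (g w <= (f w)%:E)%E) -> has_mean f x ->
  (\int[P]_w g w <= x%:E)%E.
Proof.
move=> mg g0 gf [If <-]; apply: ge0_le_integral => //.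
by have /integrableP[] := If.
Qed.

End Means.

(** * The expected cost in a fixed scenario *)

Section Core.
Variables (R : realType) (n : nat) (c v : 'I_n -> R) (X : 'I_n -> R -> R).
Hypothesis hc : forall i, 0 < c i.
Hypothesis hv : forall i, 0 <= v i.
Hypothesis hX : cp_feasible c X.
Variables (d : measure_display) (T : measurableType d) (P : probability T R).
Variable alpha : 'I_n -> T -> \bar R.
Hypothesis malpha : forall i, measurable_fun setT (alpha i).
Hypothesis law : first_arrival_law P c X alpha.
Hypothesis indep : forall A : 'I_n -> set (\bar R),
  (forall i, measurable (A i : set (\bar R))) ->
  P (\bigcap_(i in [set: 'I_n]) (alpha i @^-1` A i)) = (\prod_(i < n) P (alpha i @^-1` A i))%E.

Notation Lam := (Lambda c X).
Notation S := (surv c v Lam).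
Notation mu := (@lebesgue_measure R).

Let mpre i (A : set (\bar R)) : measurable A -> measurable (alpha i @^-1` A).
Proof. by move=> mA; rewrite -[_ @^-1` _]setTI; exact: malpha. Qed.

Let mgt (x : R) : measurable [set z : \bar R | (x%:E < z)%E].
Proof.
rewrite (_ : [set _ | _] = [set` `]x%:E, +oo%E]]); first exact: emeasurable_itv.
by apply/seteqP; split => z /=; rewrite in_itv /= leey andbT.
Qed.

Let mtau (s b : R) : measurable [set z : \bar R | (s%:E < Order.max z b%:E)%E].
Proof.
case: (ltP s b) => sb.
  rewrite (_ : [set _ | _] = setT) //.
  by apply/seteqP; split => z //= _; rewrite lt_max lte_fin sb orbT.
rewrite (_ : [set _ | _] = [set z | (s%:E < z)%E]) //.
by apply/seteqP; split => z /=; rewrite lt_max lte_fin [s < b]ltNge sb orbF.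
Qed.

Let moc (x y : R) : measurable [set z : \bar R | (x%:E < z <= y%:E)%E].
Proof.
rewrite (_ : [set _ | _] = [set` `]x%:E, y%:E]]); first exact: emeasurable_itv.
by apply/seteqP; split => z /=; rewrite in_itv.
Qed.

(** The probability that box [j] has not stopped the process by time [s], as [P_tau] shows. *)
Let q j s := if c j + v j <= s then expR (- Lam j s) else 1.

Let q_gt0 j s : 0 < q j s.
Proof. by rewrite /q; case: ifP => // _; exact: expR_gt0. Qed.

Let survE s : S s = \prod_(j < n) q j s.
Proof.
by rewrite /surv /hazard -sumrN expR_sum big_mkcond.
Qed.

Let P_tau j (s : R) : 0 <= s ->
  P (alpha j @^-1` [set z | (s%:E < Order.max z (c j + v j)%:E)%E]) = (q j s)%:E.
Proof.
move=> s0; rewrite /q; case: ifP => sb; last first.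
  rewrite (_ : _ @^-1` _ = setT); first exact: probability_setT.
  apply/seteqP; split => w //= _; by rewrite lt_max lte_fin [s < _]ltNge sb orbT.
rewrite -(law j s0); congr (P _).
by apply/seteqP; split => w /=; rewrite lt_max lte_fin [s < _]ltNge sb orbF.
Qed.

Let P_oc j (x y : R) : 0 <= x -> x <= y ->
  P (alpha j @^-1` [set z | (x%:E < z <= y%:E)%E]) =
  (expR (- Lam j x) - expR (- Lam j y))%:E.
Proof.
move=> x0 xy; have y0 := le_trans x0 xy.
have -> : alpha j @^-1` [set z | (x%:E < z <= y%:E)%E] =
  [set w | (x%:E < alpha j w)%E] `\` [set w | (y%:E < alpha j w)%E].
  apply/seteqP; split => w /=.
    by move=> /andP[-> h]; split => //; apply/negP; rewrite -leNgt.
  by move=> [-> /negP]; rewrite -leNgt.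
rewrite measureD; [|exact: mpre (mgt x)|exact: mpre (mgt y)|]; last first.
  apply: le_lt_trans (probability_le1 P _) _; last exact: ltry.
  exact: mpre (mgt x).
rewrite setIidr; last by move=> w /=; apply: le_lt_trans; rewrite lee_fin.
by rewrite EFinB; congr (_ - _)%E; exact: law.
Qed.

Let P_gt_tau_star (s : R) : 0 <= s ->
  measurable [set w | (s%:E < tau_star c v (alpha^~ w))%E] /\
  P [set w | (s%:E < tau_star c v (alpha^~ w))%E] = (S s)%:E.
Proof.
move=> s0.
have -> : [set w | (s%:E < tau_star c v (alpha^~ w))%E] =
  \bigcap_(j in [set: 'I_n])
    (alpha j @^-1` [set z | (s%:E < Order.max z (c j + v j)%:E)%E]).
  apply/seteqP; split => w /=; rewrite lt_tau_star.
    by move=> /forallP h j _; exact: h.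
  by move=> h; apply/forallP => j; exact: h.
split; first by apply: fin_bigcap_measurable => // j _; apply: mpre; exact: mtau.
rewrite indep; last by move=> j; exact: mtau.
by rewrite (eq_bigr (fun j => (q j s)%:E)) ?prodEFin ?survE// => j _; exact: P_tau.
Qed.

Let P_lone i (x y s : R) : 0 <= x -> x <= y -> 0 <= s ->
  measurable [set w | lone_arrival c v i x y s (alpha^~ w)] /\
  P [set w | lone_arrival c v i x y s (alpha^~ w)] =
  ((expR (- Lam i x) - expR (- Lam i y)) * \prod_(j < n | j != i) q j s)%:E.
Proof.
move=> x0 xy s0.
pose A j := if j == i then [set z : \bar R | (x%:E < z <= y%:E)%E]
  else [set z | (s%:E < Order.max z (c j + v j)%:E)%E].
have mA j : measurable (A j : set (\bar R)).
  by rewrite /A; case: ifP => _; [exact: moc | exact: mtau].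
have -> : [set w | lone_arrival c v i x y s (alpha^~ w)] =
  \bigcap_(j in [set: 'I_n]) (alpha j @^-1` A j).
  apply/seteqP; split => w /=.
    move=> /and3P[xw wy /forallP h] j _; rewrite /A /=; case: eqP => [->|/eqP ji] /=.
      by rewrite xw wy.
    by have := h j; rewrite ji.
  move=> h; have := h i I; rewrite /A /= eqxx /= => /andP[xw wy].
  rewrite /lone_arrival xw wy /=; apply/forallP => j; apply/implyP => ji.
  by have := h j I; rewrite /A /= (negbTE ji).
split; first by apply: fin_bigcap_measurable => // j _; exact: mpre.
rewrite indep// (bigD1 i)//= [in X in (X * _)%E]/A eqxx P_oc// EFinM; congr (_ * _)%E.
rewrite -prodEFin; apply: eq_bigr => j ji.
by rewrite /A (negbTE ji) P_tau.
Qed.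

Let prod_q i s : S s = q i s * \prod_(j < n | j != i) q j s.
Proof. by rewrite survE (bigD1 i). Qed.

Let prod_q_gt0 i s : 0 < \prod_(j < n | j != i) q j s.
Proof. by apply: prodr_gt0 => j _. Qed.

Let p_lone i x y s := (expR (- Lam i x) - expR (- Lam i y)) * \prod_(j < n | j != i) q j s.

(** By [1 + z <= exp z], the decrease of [exp (- Lam i)] over [[x, y]] is at least [exp (- Lam i y)]
    and at most [exp (- Lam i x)] times the increase of [Lam i]. Hence savings use survival up to
    the right end of a cell and openings survival up to the left end. *)
Let p_lone_ge i x y : 0 <= x -> x <= y -> c i + v i <= x ->
  S y * (Lam i y - Lam i x) <= p_lone i x y y.
Proof.
move=> x0 xy bx; rewrite (prod_q i) /p_lone mulrAC ler_pM2r//.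
rewrite /q (le_trans bx xy).
have -> : expR (- Lam i x) = expR (- Lam i y) * expR (Lam i y - Lam i x).
  by rewrite -expRD; congr expR; ring.
rewrite -[X in _ * _ - X]mulr1 -mulrBr ler_pM2l ?expR_gt0//.
by have := expR_ge1Dx (Lam i y - Lam i x); lra.
Qed.

Let exp_diff i x y : expR (- Lam i x) - expR (- Lam i y) <=
  expR (- Lam i x) * (Lam i y - Lam i x).
Proof.
have -> : expR (- Lam i y) = expR (- Lam i x) * expR (Lam i x - Lam i y).
  by rewrite -expRD; congr expR; ring.
rewrite -{1}[expR (- Lam i x)]mulr1 -mulrBr ler_pM2l ?expR_gt0//.
by have := expR_ge1Dx (Lam i x - Lam i y); lra.
Qed.

Let p_lone_le i x y : 0 <= x -> x <= y ->
  p_lone i x y x <= S x * (Lam i y - Lam i x).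
Proof.
move=> x0 xy; rewrite (prod_q i) /p_lone mulrAC ler_pM2r//.
apply: le_trans (exp_diff i x y) _; rewrite ler_wpM2r ?subr_ge0 ?(Lambda_le hc hX)//.
rewrite /q; case: ifP => // _; rewrite -[leRHS]expR0 ler_expR oppr_le0.
exact: (Lambda_ge0 hc hX).
Qed.

Section Grid.
Variables (t0 r : R) (N : nat).
Hypothesis t00 : 0 < t0.
Hypothesis r1 : 1 < r.
Notation t := (grid t0 r).
Notation dt k := (t k.+1 - t k).
Notation D i k := (Lam i (t k.+1) - Lam i (t k)).

Let tk0 k : 0 <= t k. Proof. by apply: ltW; apply: grid_gt0. Qed.
Let tkS k : t k <= t k.+1. Proof. exact: grid_le. Qed.

Let mean_lone i k (s : R) : 0 <= s ->
  has_mean P (fun w => (lone_arrival c v i (t k) (t k.+1) s (alpha^~ w))%:R)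
    (p_lone i (t k) (t k.+1) s).
Proof.
by move=> s0; have [m e] := P_lone i (tk0 k) (tkS k) s0; exact: has_mean_bool.
Qed.

Let mean_first j :
  has_mean P (fun w => (alpha j w <= t0%:E)%E%:R) (1 - expR (- Lam j t0)).
Proof.
apply: has_mean_bool.
  rewrite (_ : [set _ | _] = ~` [set w | (t0%:E < alpha j w)%E]).
    by apply: measurableC; exact: mpre (mgt t0).
  by apply/seteqP; split => w /=; rewrite leNgt => /negP.
rewrite (_ : [set _ | _] = ~` [set w | (t0%:E < alpha j w)%E]).
  rewrite probability_setC; last exact: mpre (mgt t0).
  by rewrite law ?(ltW t00)// EFinB.
by apply/seteqP; split => w /=; rewrite leNgt => /negP.
Qed.

(** A finite horizon makes the grid finite; the paths beyond it are treated as a tail in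
    [mean_bs_cost_le]. *)
Definition stopped_cost (M : R) w : \bar R :=
  if (tau_star c v (alpha^~ w) <= M%:E)%E then bs_cost c v (alpha^~ w) else 0%E.

Lemma measurable_stopped_cost M : measurable_fun setT (stopped_cost M).
Proof.
have mv i : measurable_fun setT (fun _ : T => v i) by exact: measurable_cst.
apply: measurable_fun_ifT; [|exact: (measurable_bs_cost c mv malpha)|exact: measurable_cst].
apply: measurable_fun_lee; [exact: (measurable_tau_star c mv malpha)|exact: measurable_cst].
Qed.

Lemma stopped_cost_ge0 M w : (0 <= stopped_cost M w)%E.
Proof. by rewrite /stopped_cost; case: ifP => // _; exact: bs_cost_ge0. Qed.

(** Openings and elapsed time each contribute at most [t0] plus the sum of [dt k * S (t k)], which
    gives the factor 2. For the openings this is the capacity bound [sum_c_LambdaB_le]. *)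
Lemma mean_stopped_cost_grid :
  (\int[P]_w stopped_cost (t N) w <=
   (2 * t0 + (2 * \sum_(k < N) dt k * S (t k)
    - \sum_(k < N) S (t k.+1) * \sum_(i < n | c i + v i <= t k) (t k - v i) * D i k))%:E)%E.
Proof.
pose xop := \sum_(j < n) c j * (1 - expR (- Lam j t0)) +
  \sum_(k < N) \sum_(j < n) c j * p_lone j (t k) (t k.+1) (t k).
pose xtm := t0 + \sum_(k < N) dt k * S (t k).
pose xsv := \sum_(k < N) \sum_(i < n | c i + v i <= t k)
  (t k - v i) * p_lone i (t k) (t k.+1) (t k.+1).
have hop : has_mean P (fun w => opening_bound c v t0 r N (alpha^~ w)) xop.
  apply: has_meanD; first by apply: has_mean_sum => j; apply: has_meanZ; exact: mean_first.
  apply: has_mean_sum => k; apply: has_mean_sum => j; apply: has_meanZ.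
  exact: mean_lone.
have htm : has_mean P (fun w => time_bound c v t0 r N (alpha^~ w)) xtm.
  apply: has_meanD; first exact: has_mean_cst.
  apply: has_mean_sum => k; apply: has_meanZ.
  by have [m e] := P_gt_tau_star (tk0 k); exact: has_mean_bool.
have hsv : has_mean P (fun w => saving c v t0 r N (alpha^~ w)) xsv.
  apply: has_mean_sum => k; apply: has_mean_sum => i; apply: has_meanZ.
  exact: mean_lone.
have := le_has_mean (measurable_stopped_cost (t N)) (stopped_cost_ge0 (t N)) _
  (has_meanB (has_meanD hop htm) hsv).
move=> H; apply: le_trans (H _) _ => {H}.
  move=> w; rewrite /stopped_cost; case: ifP => tsN.
    exact: bs_cost_pathwise.
  by rewrite lee_fin subr_ge0 saving_le.
rewrite lee_fin.
have first : \sum_(j < n) c j * (1 - expR (- Lam j t0)) <= t0.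
  apply: (@le_trans _ _ (\sum_(j < n) c j * (Lam j t0 - Lam j 0))).
    apply: ler_sum => j _; rewrite ler_pM2l// (Lambda0 c X).
    by have := expR_ge1Dx (- Lam j t0); lra.
  by have := sum_c_LambdaB_le hc hX (lexx 0) (ltW t00); rewrite subr0.
have later : \sum_(k < N) \sum_(j < n) c j * p_lone j (t k) (t k.+1) (t k) <=
    \sum_(k < N) dt k * S (t k).
  apply: ler_sum => k _.
  apply: (@le_trans _ _ (S (t k) * \sum_(j < n) c j * D j k)).
    rewrite mulr_sumr; apply: ler_sum => j _; rewrite [leRHS]mulrCA ler_pM2l//.
    exact: p_lone_le.
  rewrite mulrC ler_wpM2r ?(ltW (surv_gt0 _ _ _ _))//.
  exact: sum_c_LambdaB_le.
have sv : \sum_(k < N) S (t k.+1) * \sum_(i < n | c i + v i <= t k) (t k - v i) * D i k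
    <= xsv.
  apply: ler_sum => k _; rewrite mulr_sumr; apply: ler_sum => i b.
  rewrite [leLHS]mulrCA ler_wpM2l ?p_lone_ge//.
  by have := hc i; lra.
rewrite /xop /xtm; lra.
Qed.

End Grid.

(** Take [r = (3/2)^(1/m)], [t0 = M / (3/2)^p] and [N = m p], so that the grid ends at [M]. By
    Bernoulli's inequality a large [p] makes [t0] small and a large [m] makes [r - 1] small. *)
Lemma exists_grid (M e : R) : 0 < M -> 0 < e -> exists (t0 r : R) m N,
  [/\ 0 < t0, forall i, t0 <= c i, t0 <= e & 1 < r] /\
  [/\ r ^+ m = 3 / 2, grid t0 r N = M & (r - 1) * M <= e].
Proof.
move=> M0 e0.
pose del := \big[Order.min/e]_(i < n) c i.
have del0 : 0 < del by apply/bigmin_gtP; split.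
have delc i : del <= c i by exact: bigmin_le.
have dele : del <= e by exact: bigmin_le_id.
pose p := (Num.truncn (2 * M / del)).+1.
have p1 : 2 * M / del < p%:R by exact: truncnS_gt.
have b32 : M / del <= (3 / 2) ^+ p.
  have := @bernoulli R (3 / 2) p; have h : 1 <= 3 / 2 :> R by lra.
  move=> /(_ h); apply: le_trans.
  rewrite -mulrA in p1; lra.
have p32 : 0 < (3 / 2) ^+ p :> R by rewrite exprn_gt0//; lra.
pose m := (Num.truncn (M / e)).+1.
have m1 : M / e < m%:R by exact: truncnS_gt.
have m0 : 0 < m%:R :> R by rewrite ltr0n.
pose r := expR (m%:R^-1 * ln (3 / 2) : R).
have rm : r ^+ m = 3 / 2.
  by rewrite /r -expRM_natl mulrA divff ?lt0r_neq0// mul1r lnK// posrE; lra.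
have r1 : 1 < r.
  by rewrite /r expR_gt1 mulr_gt0 ?invr_gt0// ln_gt0//; lra.
have Me : M <= m%:R * e by rewrite -ler_pdivrMr// ltW.
have B := bernoulli m (ltW r1); rewrite rm in B.
exists (M / (3 / 2) ^+ p), r, m, (m * p)%N; split; split => //.
- by rewrite divr_gt0.
- move=> i; apply: le_trans (delc i).
  by rewrite ler_pdivrMr// mulrC -ler_pdivrMr.
- by apply: le_trans dele; rewrite ler_pdivrMr// mulrC -ler_pdivrMr.
- by rewrite /grid exprM rm divfK// lt0r_neq0.
- apply: (@le_trans _ _ ((r - 1) * (m%:R * e))).
    by rewrite ler_wpM2l// subr_ge0 ltW.
  rewrite mulrA ler_piMl ?(ltW e0)//; lra.
Qed.

Lemma mean_stopped_cost (M e : R) : 0 < M -> 0 < e ->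
  (\int[P]_w stopped_cost M w <=
   (4 * \int[mu]_(x in `[0, (M / 2)%R]) unserved c v X x + e)%:E)%E.
Proof.
(* The total error is [2 t0], four truncation errors and [6 (r - 1) M]: twelve terms of size at most
   [e / 12]. *)
move=> M0 e0; have e12 : 0 < e / 12 by lra.
have M2 : 0 < M / 2 by lra.
have [t0 [r [m [N [[t00 t0c t0e r1] [rm tN rM]]]]]] := exists_grid M0 e12.
have [h [[h1 h2 h3 h4] [h5 h6]]] := truncation hc hv hX M2 e12.
have := mean_stopped_cost_grid N t00 r1; rewrite tN => H.
apply: le_trans H _; rewrite lee_fin.
have hLam i s t : 0 < s -> s <= t -> 2 * (1 - s / t) * h i (s / 2) <= Lam i t - Lam i s.
  move=> s0 st; apply: le_trans (LambdaB_ge hc hX i s0 st).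
  rewrite ler_wpM2l//.
  by rewrite mulr_ge0// subr_ge0 ler_pdivrMr ?mul1r// (lt_le_trans s0).
have G := grid_inequality hc hv (Lambda_ge0 hc hX) (Lambda_le hc hX) h1 h2 hLam N
  t00 t0c r1 rm h4 h5.
have hL i : h i (grid t0 r N / 2 - v i) = h i (M / 2 - v i) by rewrite tN.
have I := grid_sum_le_integral t00 r1 t0c hv h1 h2 h4 h5 hL.
rewrite tN in G I; rewrite /= in G; lra.
Qed.

Let I := (\int[mu]_(x in `[0%R, +oo[) (unserved c v X x)%:E)%E.

Let unserved_ge0 x : 0 <= unserved c v X x.
Proof. by rewrite /unserved le_max lexx orbT. Qed.

Let Rint_unserved_le (K : R) : ((\int[mu]_(x in `[0, K]) unserved c v X x)%:E <= I)%E.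
Proof.
have bU := unserved_bmeas v hX.
rewrite /Rintegral fineK; last first.
  by apply: integrable_fin_num => //; exact: bmeas_integrable.
apply: ge0_subset_integral => //.
- by apply/measurable_EFinP; apply: measurable_funS bU.1.
- by move=> x _; rewrite lee_fin.
- by move=> x /=; rewrite !in_itv /= => /andP[-> _].
Qed.

(** If no box were ever served, the integrand would be at least 1 everywhere and its integral
    infinite. *)
Let exists_served : (I < +oo)%E -> exists x i, 0 < Xpos X i (x - v i - c i).
Proof.
move=> Iy; apply: contrapT => no.
have U1 x : 1 <= unserved c v X x.
  rewrite /unserved le_max; apply/orP; left; rewrite /served big1 ?subr0// => i _.
  apply: le_anti; rewrite (andP (Xpos_bounds hX i _)).1 andbT leNgt.
  by apply/negP => p; apply: no; exists x, i.
have I0 : (0 <= I)%E by apply: integral_ge0 => x _; rewrite lee_fin.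
have If : I \is a fin_num by rewrite ge0_fin_numE.
pose K := fine I + 1; have K0 : 0 <= K by rewrite addr_ge0// fine_ge0.
have := Rint_unserved_le K; rewrite -(fineK If) lee_fin leNgt => /negP; apply.
have := @Rint_le R (fun=> 1) (unserved c v X) 0 K (bmeas_cst 1) (unserved_bmeas v hX).
by rewrite Rint_cst// mul1r subr0 => /(_ (fun x _ => U1 x)); apply: lt_le_trans; rewrite ltrDl.
Qed.

(** The cumulative rate of a box with positive mass diverges by [Lambda_pinfty]. Adding [c i + v i]
    to the time ensures that this box counts in the hazard. *)
Let surv_small : (I < +oo)%E -> forall A, exists2 M, 0 < M & S M <= expR (- A).
Proof.
move=> /exists_served[x [i Xx]] A.
have p : 0 < 2 * (x - v i).
  have : 0 < x - v i - c i.
    by rewrite ltNge; apply/negP => /(Xpos_le0 hX) e; rewrite e ltxx in Xx.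
  by have := hc i; lra.
have [|M' M0 LM] := @Lambda_pinfty R n c X hc hX i _ p _ A.
  by rewrite (_ : 2 * (x - v i) / 2 = x - v i)//; field.
exists (M' + (c i + v i)); first by have := hc i; have := hv i; lra.
have bM : c i + v i <= M' + (c i + v i) by lra.
have MM : M' <= M' + (c i + v i) by have := hc i; have := hv i; lra.
rewrite /surv ler_expR lerN2; apply: (le_trans LM).
apply: (le_trans (Lambda_le hc hX i M0 MM)).
rewrite /hazard (bigD1 i)//= lerDl; apply: sumr_ge0 => j _.
by apply: (Lambda_ge0 hc hX); exact: le_trans MM.
Qed.

Lemma never_stops_null : (I < +oo)%E ->
  P [set w | tau_star c v (alpha^~ w) = +oo%E] = 0%E.
Proof.
move=> /surv_small small; set N := [set w | _].
have mN : measurable N.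
  have mv i : measurable_fun setT (fun _ : T => v i) by exact: measurable_cst.
  have := @emeasurable_itv R `[+oo%E, +oo%E]; rewrite set_itv1 => mi.
  by have := measurable_tau_star c mv malpha measurableT mi; rewrite setTI.
have Pf : P N \is a fin_num by exact: fin_num_measure.
have p0 : 0 <= fine (P N) by rewrite fine_ge0.
suff pe : fine (P N) = 0 by rewrite -(fineK Pf) pe.
apply: le_anti; rewrite p0 andbT leNgt; apply/negP => pp.
(* Write [p] for this probability. The level [1 / p] yields [p <= exp (- 1/p)], so
   [p exp (1/p) <= 1], against [p exp (1/p) >= p + 1]. *)
have [M M0 SM] := small (fine (P N))^-1.
have [m e] := P_gt_tau_star (ltW M0).
have : fine (P N) <= S M.
  rewrite -lee_fin (fineK Pf) -e; apply: le_measure; rewrite ?inE//.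
  by move=> w /= ->; exact: ltry.
move=> /le_trans /(_ SM); rewrite expRN -[leRHS]mul1r ler_pdivlMr ?expR_gt0// => h.
have := ler_wpM2l p0 (expR_ge1Dx (fine (P N))^-1).
by rewrite mulrDr mulr1 divff ?gt_eqF//; lra.
Qed.

(** Split at a horizon [M]. Beyond it almost every path still stops, at a cost of at most the sum
    [C] of all costs and volumes, so the tail contributes at most [C * S M]. *)
Lemma mean_bs_cost_le :
  (\int[P]_w bs_cost c v (alpha^~ w) <= 4%:E * I)%E.
Proof.
have I0 : (0 <= I)%E by apply: integral_ge0 => x _; rewrite lee_fin.
have [Iy|Iy] := eqVneq I +oo%E.
  by rewrite Iy gt0_muley ?leey// lte_fin.
have {}Iy : (I < +oo)%E by rewrite ltey.
have If : I \is a fin_num by rewrite ge0_fin_numE.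
have mv i : measurable_fun setT (fun _ : T => v i) by exact: measurable_cst.
apply/lee_addgt0Pr => e e0.
pose C := \sum_(j < n) (c j + v j).
have C0 : 0 <= C by apply: sumr_ge0 => j _; rewrite addr_ge0// ltW.
(* At this level [C exp (- 2 C / e) <= e / 2], because [exp (2 C / e) >= 1 + 2 C / e]. *)
have [M M0 SM] := surv_small Iy (2 * C / e).
have CS : C * S M <= e / 2.
  apply: (@le_trans _ _ (C * expR (- (2 * C / e)))); first by rewrite ler_wpM2l.
  rewrite expRN ler_pdivrMr ?expR_gt0//.
  have h := expR_ge1Dx (2 * C / e); have e2 : 0 < e / 2 by lra.
  have := ler_wpM2l (ltW e2) h; apply: le_trans.
  have -> : e / 2 * (1 + 2 * C / e) = e / 2 + C by field; rewrite lt0r_neq0.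
  by lra.
have [m Pm] := P_gt_tau_star (ltW M0).
have [it mt] := has_meanZ C (has_mean_bool m Pm).
pose tail w := (C * (M%:E < tau_star c v (alpha^~ w))%E%:R)%:E.
have tail0 w : (0 <= tail w)%E by rewrite lee_fin mulr_ge0.
have mtail : measurable_fun setT tail by have /integrableP[] := it.
have ms := measurable_stopped_cost M.
apply: (@le_trans _ _ (\int[P]_w (stopped_cost M w + tail w))%E).
  apply: ae_ge0_le_integral => //.
  - by move=> w _; exact: bs_cost_ge0.
  - exact: (measurable_bs_cost c mv malpha).
  - by move=> w _; rewrite adde_ge0// stopped_cost_ge0.
  - exact: emeasurable_funD.
  exists [set w | tau_star c v (alpha^~ w) = +oo%E]; split.
  - have := @emeasurable_itv R `[+oo%E, +oo%E]; rewrite set_itv1 => mi.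
    by have := measurable_tau_star c mv malpha measurableT mi; rewrite setTI.
  - exact: never_stops_null.
  move=> w /= nle; apply: contrapT => fin; apply: nle => _.
  have ts : (tau_star c v (alpha^~ w) < +oo)%E by rewrite ltey; apply/eqP.
  rewrite /stopped_cost /tail; case: ifP => tsM.
    by rewrite leeDl// lee_fin mulr_ge0.
  rewrite ltNge tsM /= mulr1 add0e; exact: bs_cost_le_total.
rewrite ge0_integralD//; last by move=> w _; exact: stopped_cost_ge0.
rewrite [X in (_ + X)%E]mt.
have e2 : 0 < e / 2 by lra.
have H := mean_stopped_cost M0 e2; have U := Rint_unserved_le (M / 2).
apply: le_trans (leeD H (lexx _)) _.
rewrite -(fineK If) lee_fin in U; rewrite -(fineK If) -EFinM -!EFinD lee_fin.
lra.
Qed.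

End Core.

(** * Independence and integration over the scenario *)

(** For fixed [B], the measures [P (A & B)] and [P A * P B] in [A] agree on a generating pi-system,
    hence on its sigma-algebra. This is applied once to each factor. *)
Lemma g_sigma_algebra_indep (R : realType) d (T : measurableType d) (P : probability T R)
    (G1 G2 : set (set T)) :
  G1 `<=` measurable -> G2 `<=` measurable -> G1 setT -> G2 setT ->
  setI_closed G1 -> setI_closed G2 ->
  (forall A B, G1 A -> G2 B -> P (A `&` B) = (P A * P B)%E) ->
  forall A B, <<s G1 >> A -> <<s G2 >> B -> P (A `&` B) = (P A * P B)%E.
Proof.
move=> sub1 sub2 T1 T2 I1 I2 H.
have fin A : measurable A -> P A = (fine (P A))%:E.
  by move=> mA; rewrite fineK// fin_num_measure.
have nn A : 0 <= fine (P A) by rewrite fine_ge0.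
have cover : \bigcup_(k : nat) [set: T] = setT by rewrite bigcup_const//; exists 0%N.
have ext (G : set (set T)) B : G `<=` measurable -> G setT -> setI_closed G ->
    measurable B -> (forall A, G A -> P (A `&` B) = (P A * P B)%E) ->
    forall A, <<s G >> A -> P (A `&` B) = (P A * P B)%E.
  move=> sub GT GI mB HG A sA.
  have e C : mscale (NngNum (nn B)) P C = (P C * P B)%E.
    by rewrite muleC [in RHS](fin B mB).
  rewrite -e; apply: (@g_sigma_algebra_measure_unique _ _ _ G sub (fun=> setT) (fun=> GT)
    cover (mrestr P mB) (mscale (NngNum (nn B)) P) GI) => //.
  - by move=> C GC; exact: etrans (HG C GC) (esym (e C)).
  - move=> _; apply: le_lt_trans (probability_le1 P _) _; last exact: ltry.
    by apply: measurableI.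
have ms G : G `<=` measurable -> <<s G >> `<=` @measurable _ T.
  by move=> sub; apply: smallest_sub => //; exact: sigma_algebra_measurable.
move=> A B sA sB.
apply: (ext G1) => //; first exact: ms sB.
move=> C GC; rewrite setIC muleC; apply: (ext G2) => //; first exact: sub1.
by move=> D GD; rewrite setIC muleC; exact: H.
Qed.

(** Independence makes the joint law of [U] and [W] the product of their laws; then Tonelli's
    theorem applies. *)
Lemma integral_indep (R : realType) d d1 d2 (T : measurableType d) (T1 : measurableType d1)
    (T2 : measurableType d2) (P : probability T R) (U : {mfun T >-> T1}) (W : {mfun T >-> T2})
    (f : T1 * T2 -> \bar R) :
  (forall A B, measurable A -> measurable B ->
     P ((U @^-1` A) `&` (W @^-1` B)) = (P (U @^-1` A) * P (W @^-1` B))%E) ->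
  measurable_fun setT f -> (forall z, (0 <= f z)%E) ->
  measurable_fun setT (fun w => \int[P]_w' f (U w, W w'))%E /\
  (\int[P]_w f (U w, W w) = \int[P]_w \int[P]_w' f (U w, W w'))%E.
Proof.
move=> UW mf f0.
pose m1 := distribution P U; pose m2 := distribution P W.
pose g w := (U w, W w).
have mg : measurable_fun setT g by exact: measurable_fun_pair.
have @pr : {mfun T >-> (T1 * T2)%type} := HB.pack g (isMeasurableFun.Build _ _ _ _ g mg).
have FE x : fubini_F m2 f x = (\int[P]_w' f (x, W w'))%E.
  rewrite /fubini_F (ge0_integral_distribution W (f := fun y => f (x, y)))//.
  by apply: measurableT_comp => //; exact: measurable_pair1.
have mF := @measurable_fun_fubini_tonelli_F _ _ _ _ _ m2 f mf f0.
split.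
  have := measurableT_comp mF (measurable_funPT U).
  by apply: eq_measurable_fun => w _ /=; rewrite FE.
have -> : (\int[P]_w f (U w, W w) = \int[distribution P pr]_z f z)%E.
  by rewrite (ge0_integral_distribution pr mf f0).
have -> : (\int[distribution P pr]_z f z = \int[m1 \x m2]_z f z)%E.
  apply: eq_measure_integral => A mA _; apply/esym.
  exact: (@product_measure_unique _ _ _ _ _ m1 m2 (distribution P pr)).
rewrite fubini_tonelli1// (ge0_integral_distribution U mF).
  by apply: eq_integral => w _ /=; rewrite FE.
by move=> x; apply: integral_ge0.
Qed.

Section Rectangles.
Variables (dT dY : measure_display) (T : measurableType dT) (Y : measurableType dY) (n : nat).
Variable u : 'I_n -> T -> Y.
Hypothesis mu : forall i, measurable_fun setT (u i).

(** A pi-system generating the sigma-algebra of the whole family [u]. The space [T] with this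
    sigma-algebra, and the identity as random element, replace a product space of values. *)
Definition rectangles : set (set T) :=
  [set S | exists B : 'I_n -> set Y, (forall j, measurable (B j)) /\
    S = \bigcap_(j in [set: 'I_n]) (u j @^-1` B j)].

Lemma rectangles_measurable : rectangles `<=` measurable.
Proof.
move=> _ [B [mB ->]]; apply: fin_bigcap_measurable => // j _.
by rewrite -[_ @^-1` _]setTI; exact: mu.
Qed.

Lemma rectangles_setT : rectangles setT.
Proof. by exists (fun=> setT); split => //; apply/seteqP; split. Qed.

Lemma rectangles_setI : setI_closed rectangles.
Proof.
move=> _ _ [A [mA ->]] [B [mB ->]]; exists (fun j => A j `&` B j); split.
  by move=> j; exact: measurableI.
apply/seteqP; split => w /=; first by move=> [wA wB] j _; split; [exact: wA|exact: wB].
by move=> h; split => j _; case: (h j I).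
Qed.

Lemma measurable_rectangles_coord i :
  measurable_fun setT (u i : g_sigma_algebraType rectangles -> Y).
Proof.
move=> _ A mA; rewrite setTI; apply: sub_sigma_algebra.
exists (fun j => if j == i then A else setT); split; first by move=> j; case: ifP.
apply/seteqP; split => w /=.
  by move=> wA j _; case: eqP => [->|].
by move=> /(_ i I); rewrite eqxx.
Qed.

Lemma measurable_rectangles_id :
  measurable_fun setT (id : T -> g_sigma_algebraType rectangles).
Proof.
apply: (@measurability _ _ T (g_sigma_algebraType rectangles) setT id rectangles erefl).
move=> _ [B rB <-]; rewrite setTI preimage_id.
exact: rectangles_measurable.
Qed.

End Rectangles.

Lemma arrivals_indep (R : realType) (n : nat) d (T : measurableType d)
    (P : probability T R) (v : 'I_n -> T -> R) (alpha : 'I_n -> T -> \bar R) :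
  indep_scen_arrivals P v alpha ->
  forall A : 'I_n -> set (\bar R), (forall i, measurable (A i : set (\bar R))) ->
  P (\bigcap_(i in [set: 'I_n]) (alpha i @^-1` A i)) =
  (\prod_(i < n) P (alpha i @^-1` A i))%E.
Proof.
move=> ind A mA; have := ind (fun=> setT) A (fun=> measurableT) mA.
have -> : \bigcap_(j in [set: 'I_n]) v j @^-1` setT = setT by apply/seteqP; split.
by rewrite setTI [P setT]probability_setT mul1e => ->.
Qed.

(** The sample space is used twice, with the sigma-algebra of the scenario and with that of the
    arrivals. The two identity maps are then independent, and the cost is jointly measurable on the
    product. *)
Lemma integral_bs_cost_indep (R : realType) (n : nat) (c : 'I_n -> R) d
    (T : measurableType d) (P : probability T R) (v : 'I_n -> T -> R)
    (alpha : 'I_n -> T -> \bar R) :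
  (forall i, 0 < c i) -> (forall i w, 0 <= v i w) ->
  (forall i, measurable_fun setT (v i)) -> (forall i, measurable_fun setT (alpha i)) ->
  indep_scen_arrivals P v alpha ->
  measurable_fun setT (fun w => \int[P]_w' bs_cost c (v^~ w) (alpha^~ w'))%E /\
  (\int[P]_w bs_cost c (v^~ w) (alpha^~ w) =
   \int[P]_w \int[P]_w' bs_cost c (v^~ w) (alpha^~ w'))%E.
Proof.
move=> hc v0 mv ma ind.
pose Gv := rectangles v; pose Ga := rectangles alpha.
have @U : {mfun T >-> g_sigma_algebraType Gv} :=
  HB.pack (id : T -> g_sigma_algebraType Gv)
    (isMeasurableFun.Build _ _ _ _ _ (measurable_rectangles_id mv)).
have @W : {mfun T >-> g_sigma_algebraType Ga} :=
  HB.pack (id : T -> g_sigma_algebraType Ga)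
    (isMeasurableFun.Build _ _ _ _ _ (measurable_rectangles_id ma)).
pose f (z : g_sigma_algebraType Gv * g_sigma_algebraType Ga) :=
  bs_cost c (v^~ z.1) (alpha^~ z.2).
apply: (@integral_indep R _ _ _ T _ _ P U W f) => [A B mA mB||z].
- apply: (@g_sigma_algebra_indep R _ T P Gv Ga) => //.
  + exact: rectangles_measurable.
  + exact: rectangles_measurable.
  + exact: rectangles_setT.
  + exact: rectangles_setT.
  + exact: rectangles_setI.
  + exact: rectangles_setI.
  move=> _ _ [C [mC ->]] [D [mD ->]]; rewrite ind//; congr (_ * _)%E.
  by rewrite (arrivals_indep ind).
- have mvz i : measurable_fun setT
    (fun z : g_sigma_algebraType Gv * g_sigma_algebraType Ga => v i z.1).
    exact: (measurableT_comp (measurable_rectangles_coord (u := v) i) measurable_fst).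
  have maz i : measurable_fun setT
    (fun z : g_sigma_algebraType Gv * g_sigma_algebraType Ga => alpha i z.2).
    exact: (measurableT_comp (measurable_rectangles_coord (u := alpha) i) measurable_snd).
  exact: (measurable_bs_cost c mvz maz).
- by apply: bs_cost_ge0.
Qed.

(** The integral of a nonnegative function is a supremum over the simple functions below it, so it
    is monotone for arbitrary nonnegative functions. This compares the program's objective with the
    costs directly. *)
Lemma ge0_le_integral_nomeas (R : realType) d (T : measurableType d)
    (mu : {measure set T -> \bar R}) (D : set T) (f g : T -> \bar R) :
  (forall x, D x -> (0 <= f x)%E) -> (forall x, D x -> (f x <= g x)%E) ->
  (\int[mu]_(x in D) f x <= \int[mu]_(x in D) g x)%E.
Proof.
move=> f0 fg; have g0 x : D x -> (0 <= g x)%E by move=> Dx; exact: le_trans (f0 x Dx) (fg x Dx).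
rewrite !ge0_integralE//; apply: le_ereal_sup => _ [h hf <-]; exists h => // x.
by apply: le_trans (hf x) _; exact: lee_restrict.
Qed.

(** * The program as a relaxation of partially adaptive algorithms *)

Section FixedOrder.
Variables (R : realType) (n : nat) (c : 'I_n -> R) (sigma : {perm 'I_n}).
Hypothesis hc : forall i, 0 < c i.

Definition start_time (i : 'I_n) : R := \sum_(k < n | (k < (sigma^-1)%g i)%N) c (sigma k).

(** The strict inequality gives the value 0 at time 0 also to the first box, whose start time is
    0. *)
Definition order_sol (i : 'I_n) (t : R) : R := (start_time i < t)%R%:R.

Lemma start_time_ge0 i : 0 <= start_time i.
Proof. by apply: sumr_ge0 => k _; rewrite ltW. Qed.

Lemma start_timeD i (m : nat) : ((sigma^-1)%g i < m)%N ->
  start_time i + c i <= \sum_(k < n | (k < m)%N) c (sigma k).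
Proof.
move=> im; rewrite [leRHS](bigD1 ((sigma^-1)%g i))//= permKV [leLHS]addrC lerD2l.
rewrite /start_time big_mkcond [leRHS]big_mkcond /=; apply: ler_sum => k _.
case: ifP => ki; last by case: ifP => // _; rewrite ltW.
by rewrite (ltn_trans ki im) /= -val_eqE /= neq_ltn ki.
Qed.

Let order_sol_diff i t : 0 <= t ->
  order_sol i t - order_sol i (Num.max (t - c i) 0) =
  (start_time i < t <= start_time i + c i)%R%:R.
Proof.
move=> t0; rewrite /order_sol lt_max [_ < 0]ltNge start_time_ge0 orbF.
rewrite ltrBrDr; have ci := hc i.
case: (ltP (start_time i) t) => st; case: (ltP (start_time i + c i) t) => sc /=;
  rewrite ?subrr ?subr0//.
by have := lt_le_trans sc st; rewrite ltNge lerDl (ltW ci).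
Qed.

(** The opening intervals [(start, start + c]] of distinct boxes are disjoint, so at most one term
    of the capacity sum is 1. *)
Lemma order_sol_feasible : cp_feasible c order_sol.
Proof.
split.
- by move=> i t _; rewrite /order_sol; case: (_ < _); rewrite ?lexx ?ler01.
- move=> i s t _ st; rewrite /order_sol ler_nat; case: (ltP _ s) => // h.
  by rewrite (lt_le_trans h st).
- by move=> i; rewrite /order_sol ltNge start_time_ge0.
move=> t t0; under eq_bigr do rewrite order_sol_diff//.
have disj i j : start_time i < t <= start_time i + c i ->
    start_time j < t <= start_time j + c j -> i = j.
  move=> /andP[i1 i2] /andP[j1 j2]; apply: (@perm_inj _ (sigma^-1)%g).
  apply: val_inj; apply/eqP; rewrite eqn_leq; apply/andP; split; rewrite leqNgt;
    apply/negP => lt.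
    have := start_timeD lt; rewrite -/(start_time i) => h.
    by have := lt_le_trans i1 (le_trans j2 h); rewrite ltxx.
  have := start_timeD lt; rewrite -/(start_time j) => h.
  by have := lt_le_trans j1 (le_trans i2 h); rewrite ltxx.
case: (pickP (fun i => start_time i < t <= start_time i + c i)) => [i hi|no]; last first.
  by rewrite big1 ?ler01// => i _; rewrite no.
rewrite (bigD1 i)//= hi big1 ?addr0// => j ji.
case: (boolP (_ < _ <= _)) => // hj.
by rewrite (disj _ _ hj hi) eqxx in ji.
Qed.

(** After time [start_time i + c i + v i], box [i] alone serves the full unit of mass, so the
    integrand is at most the indicator of the time before. *)
Lemma order_sol_integral (v : 'I_n -> R) i : (forall i, 0 <= v i) ->
  (\int[@lebesgue_measure R]_(t in `[0%R, +oo[)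
     (Num.max (1 - \sum_(i < n) order_sol i (Num.max (t - v i - c i) 0)) 0)%:E
   <= (start_time i + c i + v i)%:E)%E.
Proof.
move=> v0; set s := start_time i + c i + v i.
have s0 : 0 <= s by rewrite !addr_ge0 ?start_time_ge0// ltW.
apply: (@le_trans _ _ (\int[@lebesgue_measure R]_(t in `[0%R, +oo[) (\1_`[0, s] t)%:E)%E).
  apply: ge0_le_integral_nomeas => t /=; rewrite in_itv /= andbT => t0.
    by rewrite lee_fin le_max lexx orbT.
  have nn j : 0 <= order_sol j (Num.max (t - v j - c j) 0) by rewrite /order_sol.
  rewrite lee_fin indicE; case: (leP t s) => ts.
    rewrite mem_set /=; last by rewrite in_itv /= t0 ts.
    by rewrite ge_max ler01 andbT gerBl sumr_ge0.
  rewrite ge_max ler0n andbT (bigD1 i)//=.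
  have -> : order_sol i (Num.max (t - v i - c i) 0) = 1.
    rewrite /order_sol lt_max (_ : _ < t - v i - c i) //; move: ts; rewrite /s; lra.
  apply: (@le_trans _ _ 0); last exact: ler0n.
  by rewrite opprD addrA subrr add0r oppr_le0 sumr_ge0.
have len : (@lebesgue_measure R `[0%R, s]%classic <= s%:E)%E.
  rewrite lebesgue_measure_itv /= lte_fin; case: ifP => _; last by rewrite lee_fin.
  by rewrite -EFinB subr0.
rewrite integral_indic// setIidl; first exact: len.
by move=> x /=; rewrite !in_itv /= => /andP[->].
Qed.

(** Apply [order_sol_integral] to the opened box of least volume: it is fully opened no later than
    the total opening cost. *)
Lemma order_sol_le_pa_cost stop (v : 'I_n -> R) : (forall i, 0 <= v i) ->
  (\int[@lebesgue_measure R]_(t in `[0%R, +oo[)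
     (Num.max (1 - \sum_(i < n) order_sol i (Num.max (t - v i - c i) 0)) 0)%:E
   <= pa_cost c sigma stop v)%E.
Proof.
move=> v0; rewrite /pa_cost; set K := n_opened _ _ _; rewrite sumEFin.
case: (pickP (fun j : 'I_n => (j < K)%N)) => [j0 j0K|no]; last first.
  (* With no opened box the minimum is over the empty set and the cost is infinite. *)
  by rewrite [X in (_ + X)%E]big_pred0// addey ?leey.
have [|j jK ->] := @eq_bigmin _ _ _ +oo%E j0 (fun j : 'I_n => (j < K)%N)
    (fun j => (v (sigma j))%:E) j0K; first by move=> i _; exact: leey.
apply: le_trans (order_sol_integral (sigma j) v0) _.
by rewrite -EFinD lee_fin lerD2r start_timeD// permK.
Qed.

End FixedOrder.

Lemma cp_optimal_le_OPT (R : realType) (n : nat) (c : 'I_n -> R) d (T : measurableType d)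
    (P : probability T R) (v : 'I_n -> T -> R) (X : 'I_n -> R -> R) :
  (forall i, 0 < c i) -> (forall i w, 0 <= v i w) -> cp_optimal P c v X ->
  (cp_obj P c v X <= OPT P c v)%E.
Proof.
move=> hc v0 [_ opt]; apply: le_ereal_inf_tmp => _ [sigma [stop [_ ->]]].
apply: le_trans (opt _ (order_sol_feasible sigma hc)) _.
apply: ge0_le_integral_nomeas => w _.
  by apply: integral_ge0 => t _; rewrite lee_fin le_max lexx orbT.
exact: order_sol_le_pa_cost.
Qed.

Theorem theorem4p8 (R : realType) (n : nat) (c : 'I_n -> R)
    (hc : forall i, 0 < c i)
    (d : measure_display) (T : measurableType d) (P : probability T R)
    (v : 'I_n -> T -> R)
    (hv_meas : forall i, measurable_fun setT (v i))
    (hv_nn : forall i w, 0 <= v i w)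
    (X : 'I_n -> R -> R) (hX : cp_optimal P c v X)
    (alpha : 'I_n -> T -> \bar R)
    (halpha_meas : forall i, measurable_fun setT (alpha i))
    (halpha_law : first_arrival_law P c X alpha)
    (hindep : indep_scen_arrivals P v alpha) :
  (\int[P]_w bs_cost c (fun i => v i w) (fun i => alpha i w)
     <= 4%:E * OPT P c v)%E.
Proof.
have hf := hX.1.
have [mF ->] := integral_bs_cost_indep hc hv_nn hv_meas halpha_meas hindep.
have F0 w : setT w -> (0 <= \int[P]_w' bs_cost c (v^~ w) (alpha^~ w'))%E.
  by move=> _; apply: integral_ge0 => w' _; exact: bs_cost_ge0.
(* The factor 4 is moved into the left integral, so that the comparison with the program's objective
   can be made scenario by scenario. *)
rewrite -lee_pdivrMl// -ge0_integralZl//.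
apply: le_trans (cp_optimal_le_OPT hc hv_nn hX).
apply: ge0_le_integral_nomeas => w _.
  by rewrite mule_ge0 ?F0// lee_fin invr_ge0.
rewrite lee_pdivrMl//.
exact: (mean_bs_cost_le hc (fun i => hv_nn i w) hf halpha_meas halpha_law
  (arrivals_indep hindep)).
Qed.
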